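(* Let $R$ be a commutative ring with unit, $A$ an $A_\infty$-algebra over $R$ and $M$ an $A_\infty$-bimodule over $A$. Let $M^{-*}$ be the dual $A_\infty$-bimodule of $M$, let $b$ be the Hochschild differential on $CH_*(A;M)$, let $\beta$ be the Hochschild codifferential on $CH^*(A;M^{-*})$, and let $b^*:\mathrm{Hom}(CH_*(A;M),R)\to\mathrm{Hom}(CH_*(A;M),R)$, $b^*(f)=f\circ b$. Then the map $\varphi:\mathrm{Hom}(CH_*(A;M),R)\to CH^*(A;M^{-*})$ determined by $$\big(\varphi(f)(a_1,\dots,a_n)\big)(m)=(-1)^{\mu_M(m)\cdot\maltese_1^n}f(m\otimes a_1\otimes\dots\otimes a_n)$$ for $n\in\mathbb N_0$, $f\in\mathrm{Hom}(M\otimes A^{\otimes n},R)$ and homogeneous $a_1,\dots,a_n\in A$, $m\in M$, is an isomorphism of cochain complexes of degree zero with respect to $b^*$ and $\beta$; in other words, $\varphi$ is a degree-preserving isomorphism of graded $R$-modules and $\varphi\circ b^*=\beta\circ\varphi$.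
   Context: Conventions: $\mathbb N=\{1,2,\dots\}$, $\mathbb N_0=\mathbb N\cup\{0\}$, $\otimes=\otimes_R$, graded modules are $\mathbb Z$-graded, empty sums are $0$. Formulas containing signs are stated for homogeneous elements and extended $R$-linearly. For $a\in A_j$ write $\mu(a)=j$ and $\|a\|=\mu(a)-1$. For $m\in M_j$ write $\mu(m)=\mu_M(m)=j$. For $a_1,\dots,a_n\in A$ put $\maltese_i^j=\sum_{q=i}^j\|a_q\|$ for $1\le i\le j\le n$ ($0$ if $j<i$). $A_\infty$-algebra: a graded $R$-module $A=\bigoplus_j A_j$ with graded $R$-module homomorphisms $\mu_n:A^{\otimes n}\to A$ of degree $2-n$ ($n\in\mathbb N$) such that for all $r\in\mathbb N$ and $a_1,\dots,a_r\in A$ $$\sum_{n_1,n_2\in\mathbb N,\ n_1+n_2=r+1}\ \sum_{i=1}^{r+1-n_1}(-1)^{\maltese_1^{i-1}}\mu_{n_2}(a_1,\dots,a_{i-1},\mu_{n_1}(a_i,\dots,a_{i+n_1-1}),a_{i+n_1},\dots,a_r)=0.$$ $A_\infty$-bimodule over $A$: a graded $R$-module $M=\bigoplus_jM_j$ with $R$-module homomorphisms $\mu^M_{r,s}:A^{\otimes r}\otimes M\otimes A^{\otimes s}\to M$ of degree $1-r-s$ ($r,s\in\mathbb N_0$) such that for all $r,s\in\mathbb N_0$, $m\in M$, $a_1,\dots,a_{r+s}\in A$ (with $\maltese$ computed from the $a_q$ only): $$\sum_{r_1\in\mathbb N_0,r_2\in\mathbb N,\ r_1+r_2=r+1}\sum_{i=1}^{r_1}(-1)^{\maltese_1^{i-1}}\mu^M_{r_1,s}(a_1,\dots,\mu_{r_2}(a_i,\dots,a_{i+r_2-1}),\dots,a_r,m,a_{r+1},\dots,a_{r+s})$$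 $$+\sum_{r_1+r_2=r}\ \sum_{s_1+s_2=s}(-1)^{\maltese_1^{r_1}}\mu^M_{r_1,s_1}(a_1,\dots,a_{r_1},\mu^M_{r_2,s_2}(a_{r_1+1},\dots,a_r,m,a_{r+1},\dots,a_{r+s_2}),a_{r+s_2+1},\dots,a_{r+s})$$ $$+\sum_{s_1\in\mathbb N_0,s_2\in\mathbb N,\ s_1+s_2=s+1}\sum_{j=1}^{s_1}(-1)^{\maltese_1^{r+j-1}+\mu_M(m)}\mu^M_{r,s_1}(a_1,\dots,a_r,m,a_{r+1},\dots,a_{r+j-1},\mu_{s_2}(a_{r+j},\dots,a_{r+j+s_2-1}),\dots,a_{r+s})=0,$$ where in the second line $r_1,r_2,s_1,s_2\in\mathbb N_0$. Dual bimodule: $M^{-*}$ is the graded $R$-module with degree $j$ part $(M^{-*})^j=\mathrm{Hom}_R(M_{-j},R)$; $\mu_{M^*}(m^* )=j$ for $m^*\in(M^{-*})^j$. It is an $A_\infty$-bimodule over $A$ with operations $\mu^*_{r,s}:A^{\otimes r}\otimes M^{-*}\otimes A^{\otimes s}\to M^{-*}$, $$\big(\mu^*_{r,s}(a_1,\dots,a_r,m^*,a_{r+1},\dots,a_{r+s})\big)(m)=(-1)^{\ddag_{r,s}}m^*\big(\mu^M_{s,r}(a_{r+1},\dots,a_{r+s},m,a_1,\dots,a_r)\big),$$ $$\ddag_{r,s}=\maltese_1^r\cdot\big(\maltese_{r+1}^{r+s}+\mu_{M^*}(m^* )+\mu_M(m)\big)+\mu_{M^*}(m^* )+1.$$ Hochschild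 chains: $CH_*(A;M)=\bigoplus_{n\ge0}M\otimes A^{\otimes n}$, graded by $\deg(m\otimes a_1\otimes\dots\otimes a_n)=n-\mu(m)-\sum_{q=1}^n\mu(a_q)$; $CH_j(A;M)$ is the part of degree $j$. For $m\otimes a_1\otimes\dots\otimes a_n$ put $\maltese_0^i=\mu(m)+\maltese_1^i$ and $*_{i}=\maltese_0^{i}\cdot\maltese_{i+1}^n$. The Hochschild differential (which lowers degree by one and squares to zero) is $$b(m\otimes a_1\otimes\dots\otimes a_n)=\sum_{l=1}^{n+1}\Big(\mu^M_{0,l-1}(m,a_1,\dots,a_{l-1})\otimes a_l\otimes\dots\otimes a_n$$ $$+\sum_{i=1}^{n-l+1}(-1)^{\maltese_0^{i-1}}m\otimes a_1\otimes\dots\otimes a_{i-1}\otimes\mu_l(a_i,\dots,a_{i+l-1})\otimes a_{i+l}\otimes\dots\otimes a_n$$ $$+\sum_{i=n-l+2}^{n}[i\ge1](-1)^{*_{i-1}}\mu^M_{n-i+1,\,i+l-n-2}(a_i,\dots,a_n,m,a_1,\dots,a_{i+l-n-2})\otimes a_{i+l-n-1}\otimes\dots\otimes a_{i-1}\Big),$$ where $[i\ge1]$ restricts the sum to $i\ge1$. The module $\mathrm{Hom}(CH_*(A;M),R)$ is graded with degree $j$ part $\mathrm{Hom}_R(CH_j(A;M),R)$, and one identifies $\mathrm{Hom}(CH_*(A;M),R)\cong\prod_{n\in\mathbb N_0}\mathrm{Hom}(M\otimes A^{\otimes n},R)$ (so $\varphi$ acts componentwise in $n$). Hochschild cochains with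 coefficients in an $A_\infty$-bimodule $P$ over $A$: $\mathrm{Hom}^k(A^{\otimes n},P)$ is the module of $R$-homomorphisms of degree $k$ (with $A^{\otimes n}$ carrying the tensor product grading), and $CH^*(A;P)$ is graded by $CH^j(A;P)=\prod_{n\in\mathbb N_0}\mathrm{Hom}^{j-n}(A^{\otimes n},P)$; write $\deg f=j$ for $f\in CH^j(A;P)$. The codifferential $\beta$ is defined for $f\in\mathrm{Hom}(A^{\otimes n},P)$ by letting the $\mathrm{Hom}(A^{\otimes(n+l)},P)$-component of $\beta(f)$, $l\in\mathbb N_0$, be $$(\beta(f))_l(a_1,\dots,a_{n+l})=\sum_{i=1}^n(-1)^{\maltese_1^{i-1}}f(a_1,\dots,a_{i-1},\mu_{l+1}(a_i,\dots,a_{i+l}),a_{i+l+1},\dots,a_{n+l})$$ $$+\sum_{i=1}^{l+1}(-1)^{\deg f\cdot(\maltese_1^{i-1}+1)+1}\mu^P_{i-1,l-i+1}(a_1,\dots,a_{i-1},f(a_i,\dots,a_{n+i-1}),a_{n+i},\dots,a_{n+l}),$$ and for $f=(f_n)_n$ the $\mathrm{Hom}(A^{\otimes N},P)$-component of $\beta(f)$ is $\sum_{n+l=N}(\beta(f_n))_l$. The map $\beta$ is a differential of degree $+1$. Here it is used with $P=M^{-*}$. *)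

(* Defs.v *)
(* Conventions.
   - A graded module is an R-module V with a family of submodules gr j (j : int)
     of which V is the internal direct sum. A^{⊗n}, M ⊗ A^{⊗n}, ... are the usual
     tensor products of R-modules; their degree k part is spanned by the tensors
     of homogeneous elements of total degree k.
   - A list a_1, ..., a_n of elements of A is given by a function a : nat -> A, of
     which only the values at 1, ..., n matter; d q is the degree of a q.
   - Maps which are prescribed on homogeneous elements and extended linearly are
     specified by a predicate is_..., proved to exist, and then selected by
     choice; they are unique since homogeneous tensors span. *)
From HB Require Import structures.
From mathcomp Require Import all_boot all_order all_algebra.
From mathcomp Require Import boolp zify ring.

Set Implicit Arguments.
Unset Strict Implicit.
Unset Printing Implicit Defensive.
Import Order.TTheory GRing.Theory Num.Theory.
Local Open Scope ring_scope.

Reserved Notation "u ⊗ v" (at level 39, left associativity).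

Section LinearMaps.
Variables (R : comPzRingType) (U V : lmodType R).
Implicit Types (f g : {linear U -> V}) (c : R).

Lemma linear_ext f g : f =1 g -> f = g.
Proof.
case: f g => [f cf] [g cg] /= /funext efg; subst g.
congr (GRing.Linear.Pack _).
case: cf cg => [[Mf] [Af]] [[Mg] [Ag]].
by rewrite (Prop_irrelevance Mf Mg) (Prop_irrelevance Af Ag).
Qed.

Definition mk_linear (f : U -> V) (lf : linear f) : {linear U -> V} :=
  HB.pack f (GRing.isLinear.Build R U V *:%R f lf).

Lemma lin_zero_subproof : linear (fun _ : U => 0 : V).
Proof. by move=> c u v; rewrite scaler0 addr0. Qed.
Lemma lin_opp_subproof f : linear (fun u => - f u).
Proof. by move=> c u v; rewrite linearP opprD scalerN. Qed.
Lemma lin_add_subproof f g : linear (fun u => f u + g u).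
Proof. by move=> c u v; rewrite !linearP scalerDr addrACA. Qed.
Lemma lin_scale_subproof c f : linear (fun u => c *: f u).
Proof. by move=> d u v; rewrite linearP scalerDr !scalerA mulrC. Qed.

Let lin_zero := mk_linear lin_zero_subproof.
Let lin_opp f := mk_linear (lin_opp_subproof f).
Let lin_add f g := mk_linear (lin_add_subproof f g).
Let lin_scale c f := mk_linear (lin_scale_subproof c f).

Let lin_addA : associative lin_add.
Proof. by move=> f g h; apply: linear_ext => u /=; rewrite addrA. Qed.
Let lin_addC : commutative lin_add.
Proof. by move=> f g; apply: linear_ext => u /=; rewrite addrC. Qed.
Let lin_add0 : left_id lin_zero lin_add.
Proof. by move=> f; apply: linear_ext => u /=; rewrite add0r. Qed.
Let lin_addN : left_inverse lin_zero lin_opp lin_add.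
Proof. by move=> f; apply: linear_ext => u /=; rewrite addNr. Qed.

HB.instance Definition _ := gen_eqMixin {linear U -> V}.
HB.instance Definition _ := gen_choiceMixin {linear U -> V}.
HB.instance Definition _ :=
  GRing.isZmodule.Build {linear U -> V} lin_addA lin_addC lin_add0 lin_addN.

Let lin_scaleA c d f : lin_scale c (lin_scale d f) = lin_scale (c * d) f.
Proof. by apply: linear_ext => u /=; rewrite scalerA. Qed.
Let lin_scale1 : left_id 1 lin_scale.
Proof. by move=> f; apply: linear_ext => u /=; rewrite scale1r. Qed.
Let lin_scaleDr : right_distributive lin_scale +%R.
Proof. by move=> c f g; apply: linear_ext => u /=; rewrite scalerDr. Qed.
Let lin_scaleDl f : {morph lin_scale^~ f : c d / c + d}.
Proof. by move=> c d; apply: linear_ext => u /=; rewrite scalerDl. Qed.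

HB.instance Definition _ := GRing.Zmodule_isLmodule.Build R {linear U -> V}
  lin_scaleA lin_scale1 lin_scaleDr lin_scaleDl.

Lemma lin_addE f g u : (f + g) u = f u + g u. Proof. by []. Qed.
Lemma lin_oppE f u : (- f) u = - f u. Proof. by []. Qed.
Lemma lin_zeroE u : (0 : {linear U -> V}) u = 0. Proof. by []. Qed.
Lemma lin_scaleE c f u : (c *: f) u = c *: f u. Proof. by []. Qed.
End LinearMaps.

Section DirectProduct.
Variables (R : pzRingType) (I : Type) (V : I -> lmodType R).

Definition dprod : Type := forall i, V i.

Let dadd (x y : dprod) : dprod := fun i => x i + y i.
Let dopp (x : dprod) : dprod := fun i => - x i.
Let dscale c (x : dprod) : dprod := fun i => c *: x i.

Let daddA : associative dadd.
Proof. by move=> x y z; apply: functional_extensionality_dep => i; exact: addrA. Qed.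
Let daddC : commutative dadd.
Proof. by move=> x y; apply: functional_extensionality_dep => i; exact: addrC. Qed.
Let dadd0 : left_id (fun i => 0) dadd.
Proof. by move=> x; apply: functional_extensionality_dep => i; exact: add0r. Qed.
Let daddN : left_inverse (fun i => 0) dopp dadd.
Proof. by move=> x; apply: functional_extensionality_dep => i; exact: addNr. Qed.

HB.instance Definition _ := gen_eqMixin dprod.
HB.instance Definition _ := gen_choiceMixin dprod.
HB.instance Definition _ := GRing.isZmodule.Build dprod daddA daddC dadd0 daddN.

Let dscaleA c d x : dscale c (dscale d x) = dscale (c * d) x.
Proof. by apply: functional_extensionality_dep => i; exact: scalerA. Qed.
Let dscale1 : left_id 1 dscale.
Proof. by move=> x; apply: functional_extensionality_dep => i; exact: scale1r. Qed.
Let dscaleDr : right_distributive dscale +%R.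
Proof. by move=> c x y; apply: functional_extensionality_dep => i; exact: scalerDr. Qed.
Let dscaleDl x : {morph dscale^~ x : c d / c + d}.
Proof. by move=> c d; apply: functional_extensionality_dep => i; exact: scalerDl. Qed.

HB.instance Definition _ := GRing.Zmodule_isLmodule.Build R dprod
  dscaleA dscale1 dscaleDr dscaleDl.

Lemma dprod_addE (x y : dprod) i : (x + y) i = x i + y i. Proof. by []. Qed.
Lemma dprod_zeroE i : (0 : dprod) i = 0. Proof. by []. Qed.
Lemma dprod_scaleE c (x : dprod) i : (c *: x) i = c *: x i. Proof. by []. Qed.
End DirectProduct.

Section Submodules.
Variables (R : pzRingType) (V : lmodType R).

Record submod := Submod {
  in_submod :> V -> Prop;
  submod_zero : in_submod 0;
  submod_lin : forall c u v, in_submod u -> in_submod v ->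
    in_submod (c *: u + v) }.

Variable S : submod.

Definition submod_pred : {pred V} := fun v => `[< S v >].
Lemma submod_pred_closed : submod_closed submod_pred.
Proof.
split=> [|c u v]; rewrite !unfold_in; first exact/asboolP/submod_zero.
by move=> /asboolP Su /asboolP Sv; apply/asboolP/submod_lin.
Qed.
HB.instance Definition _ :=
  GRing.isSubmodClosed.Build R V submod_pred submod_pred_closed.

Record subm := Subm { subm_val :> V; _ : subm_val \in submod_pred }.
HB.instance Definition _ := [isSub for subm_val].
HB.instance Definition _ := [Choice of subm by <:].
HB.instance Definition _ := [SubChoice_isSubLmodule of subm by <:].

Lemma submP (x : subm) : S x. Proof. by case: x => v /= /asboolP. Qed.
Definition mk_subm v (Sv : S v) : subm := Subm (asboolT Sv).
End Submodules.

Section Tensor.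
Local Open Scope quotient_scope.
Variables (R : comPzRingType) (U V : lmodType R).
Implicit Types (u : U) (v : V) (c : R) (s t : seq (U * V)).

(* A formal sum of pairs [:: (u1, v1); ...] stands for u1 ⊗ v1 + ... *)
Inductive tensor_rel : seq (U * V) -> seq (U * V) -> Prop :=
| tensor_refl s : tensor_rel s s
| tensor_sym s t : tensor_rel s t -> tensor_rel t s
| tensor_trans s t r : tensor_rel s t -> tensor_rel t r -> tensor_rel s r
| tensor_cat s s' t t' : tensor_rel s s' -> tensor_rel t t' ->
    tensor_rel (s ++ t) (s' ++ t')
| tensor_comm s t : tensor_rel (s ++ t) (t ++ s)
| tensor_nil : tensor_rel [:: (0, 0)] [::]
| tensor_addl u u' v : tensor_rel [:: (u + u', v)] [:: (u, v); (u', v)]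
| tensor_addr u v v' : tensor_rel [:: (u, v + v')] [:: (u, v); (u, v')]
| tensor_scale c u v : tensor_rel [:: (c *: u, v)] [:: (u, c *: v)].

Definition tensor_relb s t := `[< tensor_rel s t >].
Let relb_refl : reflexive tensor_relb.
Proof. by move=> s; apply/asboolP/tensor_refl. Qed.
Let relb_sym : symmetric tensor_relb.
Proof.
by move=> s t; apply/asboolP/asboolP => /tensor_sym.
Qed.
Let relb_trans : transitive tensor_relb.
Proof.
by move=> t s r /asboolP st /asboolP tr; apply/asboolP/(tensor_trans st).
Qed.
Canonical tensor_equiv := EquivRel tensor_relb relb_refl relb_sym relb_trans.

Definition tensor := {eq_quot tensor_equiv}.
HB.instance Definition _ := Choice.on tensor.
HB.instance Definition _ := EqQuotient.on tensor.

Let cls s : tensor := \pi_tensor s.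
Let clsP s t : reflect (cls s = cls t) `[< tensor_rel s t >].
Proof. by apply: (iffP idP) => [h|/eqmodP//]; apply/eqmodP. Qed.
Let cls_eq s t : tensor_rel s t -> cls s = cls t.
Proof. by move=> h; apply/clsP/asboolP. Qed.
Let cls_rel s t : cls s = cls t -> tensor_rel s t.
Proof. by move/clsP/asboolP. Qed.
Let reprE s : tensor_rel (repr (cls s)) s.
Proof. by apply: cls_rel; rewrite /cls reprK. Qed.
Let clsK (x : tensor) : cls (repr x) = x. Proof. exact: reprK. Qed.

Let sc c s := [seq (c *: p.1, p.2) | p <- s].

Let sc_rel c s t : tensor_rel s t -> tensor_rel (sc c s) (sc c t).
Proof.
elim=> {s t} /=.
- by move=> s; apply: tensor_refl.
- by move=> s t _; apply: tensor_sym.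
- by move=> s t r _ h1 _; apply: tensor_trans.
- by move=> s s' t t' _ h1 _ h2; rewrite /sc !map_cat; apply: tensor_cat.
- by move=> s t; rewrite /sc !map_cat; apply: tensor_comm.
- by rewrite scaler0; apply: tensor_nil.
- by move=> u u' v; rewrite scalerDr; apply: tensor_addl.
- by move=> u v v'; apply: tensor_addr.
- by move=> d u v; rewrite scalerA mulrC -scalerA; apply: tensor_scale.
Qed.

Let zero_rel v : tensor_rel [:: (0, v)] [::].
Proof.
have h := tensor_scale 0 0 v; rewrite !scale0r in h.
exact: tensor_trans h tensor_nil.
Qed.

Let tadd (x y : tensor) : tensor := cls (repr x ++ repr y).
Let topp (x : tensor) : tensor := cls (sc (-1) (repr x)).
Let tscale c (x : tensor) : tensor := cls (sc c (repr x)).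

Let tadd_cls s t : tadd (cls s) (cls t) = cls (s ++ t).
Proof. by apply: cls_eq; apply: tensor_cat; apply: reprE. Qed.
Let topp_cls s : topp (cls s) = cls (sc (-1) s).
Proof. by apply: cls_eq; apply: sc_rel; apply: reprE. Qed.
Let tscale_cls c s : tscale c (cls s) = cls (sc c s).
Proof. by apply: cls_eq; apply: sc_rel; apply: reprE. Qed.

Let taddA : associative tadd.
Proof.
by move=> x y z; rewrite -[x]clsK -[y]clsK -[z]clsK !tadd_cls catA.
Qed.
Let taddC : commutative tadd.
Proof. by move=> x y; apply/cls_eq/tensor_comm. Qed.
Let tadd0 : left_id (cls [::]) tadd.
Proof. by move=> x; rewrite -[x]clsK tadd_cls. Qed.
Let taddN : left_inverse (cls [::]) topp tadd.
Proof.
move=> x; rewrite -[x]clsK topp_cls tadd_cls; apply: cls_eq.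
elim: (repr x) => [|[u v] s IH] /=; first exact: tensor_refl.
have -> : (-1 *: u, v) :: sc (-1) s ++ (u, v) :: s
   = [:: (-1 *: u, v)] ++ ((sc (-1) s ++ [:: (u, v)]) ++ s).
  by rewrite -catA.
apply: (@tensor_trans _ ([:: (-1 *: u, v)] ++ (([:: (u, v)] ++ sc (-1) s) ++ s))).
  apply: tensor_cat (tensor_refl _) _.
  by apply: tensor_cat (tensor_comm _ _) (tensor_refl _).
have -> : [:: (-1 *: u, v)] ++ (([:: (u, v)] ++ sc (-1) s) ++ s)
  = [:: (-1 *: u, v); (u, v)] ++ (sc (-1) s ++ s) by [].
rewrite -[[::]]/([::] ++ [::]); apply: tensor_cat IH.
apply: tensor_trans (tensor_sym (tensor_addl _ _ _)) _.
by rewrite scaleN1r addNr; apply: zero_rel.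
Qed.
HB.instance Definition _ :=
  GRing.isZmodule.Build tensor taddA taddC tadd0 taddN.

Let tscaleA c d x : tscale c (tscale d x) = tscale (c * d) x.
Proof.
rewrite -[x]clsK !tscale_cls; congr cls; rewrite /sc -map_comp.
by apply: eq_map => p /=; rewrite scalerA.
Qed.
Let tscale1 : left_id 1 tscale.
Proof.
move=> x; rewrite -[x]clsK tscale_cls; congr cls.
by rewrite -[RHS]map_id; apply: eq_map => -[u v] /=; rewrite scale1r.
Qed.
Let tscaleDr : right_distributive tscale +%R.
Proof.
move=> c x y; rewrite -[x]clsK -[y]clsK.
change (tscale c (tadd (cls (repr x)) (cls (repr y))) =
  tadd (tscale c (cls (repr x))) (tscale c (cls (repr y)))).
rewrite [tadd (cls (repr x)) _]tadd_cls !tscale_cls tadd_cls.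
by rewrite /sc map_cat.
Qed.
Let tscaleDl x : {morph tscale^~ x : c d / c + d}.
Proof.
move=> c d; rewrite -[x]clsK.
change (tscale (c + d) (cls (repr x)) =
  tadd (tscale c (cls (repr x))) (tscale d (cls (repr x)))).
rewrite !tscale_cls tadd_cls; apply: cls_eq.
elim: (repr x) => [|[u v] s IH] /=; first exact: tensor_refl.
rewrite scalerDl.
apply: (@tensor_trans _ ([:: (c *: u, v); (d *: u, v)] ++ (sc c s ++ sc d s))).
  by rewrite -cat1s; apply: tensor_cat IH; apply: tensor_addl.
rewrite -[X in tensor_rel X _]/([:: (c *: u, v)] ++ (([:: (d *: u, v)] ++ sc c s) ++ sc d s)).
rewrite -[X in tensor_rel _ X]/([:: (c *: u, v)] ++ (sc c s ++ ([:: (d *: u, v)] ++ sc d s))).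
rewrite [sc c s ++ _]catA; apply: tensor_cat (tensor_refl _) _.
by apply: tensor_cat (tensor_comm _ _) (tensor_refl _).
Qed.
HB.instance Definition _ := GRing.Zmodule_isLmodule.Build R tensor
  tscaleA tscale1 tscaleDr tscaleDl.

Definition tpair u v : tensor := cls [:: (u, v)].

Lemma tpairDl u u' v : tpair (u + u') v = tpair u v + tpair u' v.
Proof. by rewrite -[RHS]/(tadd _ _) tadd_cls; apply/cls_eq/tensor_addl. Qed.
Lemma tpairDr u v v' : tpair u (v + v') = tpair u v + tpair u v'.
Proof. by rewrite -[RHS]/(tadd _ _) tadd_cls; apply/cls_eq/tensor_addr. Qed.
Lemma tpairZl c u v : tpair (c *: u) v = c *: tpair u v.
Proof. by rewrite -[RHS]/(tscale _ _) tscale_cls. Qed.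
Lemma tpairZr c u v : tpair u (c *: v) = c *: tpair u v.
Proof. by rewrite -tpairZl; apply/esym/cls_eq/tensor_scale. Qed.
Lemma tpairPl c u u' v : tpair (c *: u + u') v = c *: tpair u v + tpair u' v.
Proof. by rewrite tpairDl tpairZl. Qed.
Lemma tpairPr c u v v' : tpair u (c *: v + v') = c *: tpair u v + tpair u v'.
Proof. by rewrite tpairDr tpairZr. Qed.
Lemma tpair0l v : tpair 0 v = 0.
Proof. by rewrite -(scale0r (0 : U)) tpairZl scale0r. Qed.
Lemma tpair0r u : tpair u 0 = 0.
Proof. by rewrite -(scale0r (0 : V)) tpairZr scale0r. Qed.

Lemma tensor_span (x : tensor) : exists s, x = \sum_(p <- s) tpair p.1 p.2.
Proof.
exists (repr x); rewrite -[LHS]clsK.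
elim: (repr x) => [|[u v] s IH]; first by rewrite big_nil.
by rewrite big_cons -IH -[RHS]/(tadd _ _) tadd_cls.
Qed.

Section Lift.
Variables (W : lmodType R) (B : U -> V -> W).
Hypothesis Bl : forall c u u' v, B (c *: u + u') v = c *: B u v + B u' v.
Hypothesis Br : forall c u v v', B u (c *: v + v') = c *: B u v + B u v'.

Let ev s : W := \sum_(p <- s) B p.1 p.2.

Let B0l v : B 0 v = 0.
Proof.
have := Bl (-1) 0 0 v; by rewrite scaler0 addr0 scaleN1r addNr.
Qed.
Let B0r u : B u 0 = 0.
Proof.
have := Br (-1) u 0 0; by rewrite scaler0 addr0 scaleN1r addNr.
Qed.

Let ev_rel s t : tensor_rel s t -> ev s = ev t.
Proof.
elim=> {s t} //.
- by move=> s t r _ -> _ ->.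
- by move=> s s' t t' _ h1 _ h2; rewrite /ev !big_cat /= -!/(ev _) h1 h2.
- by move=> s t; rewrite /ev !big_cat /= addrC.
- by rewrite /ev big_cons !big_nil B0l addr0.
- move=> u u' v; rewrite /ev !big_cons !big_nil !addr0 /=.
  by have := Bl 1 u u' v; rewrite !scale1r.
- move=> u v v'; rewrite /ev !big_cons !big_nil !addr0 /=.
  by have := Br 1 u v v'; rewrite !scale1r.
- move=> c u v; rewrite /ev !big_cons !big_nil !addr0 /=.
  have := Bl c u 0 v; rewrite !addr0 B0l addr0 => ->.
  by have := Br c u v 0; rewrite !addr0 B0r addr0 => ->.
Qed.

Lemma tensor_lift : exists G : {linear tensor -> W},
  forall u v, G (tpair u v) = B u v.
Proof.
have G_lin : linear (fun x : tensor => ev (repr x)).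
  move=> c x y; rewrite -[c *: x]/(tscale c x) -[_ + y]/(tadd _ _).
  rewrite -{1}[x]clsK -{1}[y]clsK tscale_cls tadd_cls (ev_rel (reprE _)).
  rewrite /ev big_cat /=; congr (_ + _).
  rewrite /sc big_map scaler_sumr; apply: eq_bigr => p _ /=.
  by have := Bl c p.1 0 p.2; rewrite B0l !addr0.
exists (mk_linear G_lin) => u v /=; rewrite (ev_rel (reprE _)).
by rewrite /ev big_cons big_nil addr0.
Qed.
End Lift.

Lemma tensor_ext (W : lmodType R) (f g : {linear tensor -> W}) :
  (forall u v, f (tpair u v) = g (tpair u v)) -> f =1 g.
Proof.
move=> fg x; have [s ->] := tensor_span x; rewrite !linear_sum.
by apply: eq_bigr.
Qed.
End Tensor.

Notation "u ⊗ v" := (tpair u v) : ring_scope.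

Section Decomposition.
Variables (R : pzRingType) (V : lmodType R) (G : int -> submod V).

Definition decomposes (v : V) := exists (s : seq int) (w : int -> V),
  [/\ uniq s, forall j, G j (w j) & v = \sum_(j <- s) w j].

Definition independent := forall (s : seq int) (w : int -> V),
  uniq s -> (forall j, G j (w j)) -> \sum_(j <- s) w j = 0 ->
  forall j, j \in s -> w j = 0.

Lemma submodD (S : submod V) u v : S u -> S v -> S (u + v).
Proof. by move=> Su Sv; rewrite -[u]scale1r; apply: submod_lin. Qed.
Lemma submodZ (S : submod V) c u : S u -> S (c *: u).
Proof. by move=> Su; rewrite -[_ *: _]addr0; apply: submod_lin (submod_zero _). Qed.
Lemma submod_sum (S : submod V) I (r : seq I) (P : pred I) F :
  (forall i, P i -> S (F i)) -> S (\sum_(i <- r | P i) F i).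
Proof. by move=> SF; apply: big_ind => //; [apply: submod_zero|apply: submodD]. Qed.
Lemma submod_sum_seq (S : submod V) (I : eqType) (r : seq I) F :
  (forall i, i \in r -> S (F i)) -> S (\sum_(i <- r) F i).
Proof. by move=> SF; rewrite big_seq; apply: submod_sum. Qed.

Lemma sum_supp (s t : seq int) (w : int -> V) : uniq s -> uniq t ->
  {subset s <= t} -> (forall j, j \notin s -> w j = 0) ->
  \sum_(j <- t) w j = \sum_(j <- s) w j.
Proof.
move=> us ut st w0; rewrite (bigID (mem s)) /= addrC big1 ?add0r; last by move=> j /w0.
rewrite -big_filter; apply: perm_big; apply: uniq_perm => //; first exact: filter_uniq.
by move=> j; rewrite mem_filter andb_idr // => /st.
Qed.

Lemma decomposesP v : decomposes v -> exists (s : seq int) (w : int -> V),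
  [/\ uniq s, forall j, G j (w j), forall j, j \notin s -> w j = 0
    & v = \sum_(j <- s) w j].
Proof.
move=> [s [w [us Gw ->]]]; exists s, (fun j => if j \in s then w j else 0); split => //.
- by move=> j; case: ifP => _ //; apply: submod_zero.
- by move=> j /negbTE ->.
- by rewrite big_seq [RHS]big_seq; apply: eq_bigr => j ->.
Qed.

Lemma decomposes_zero : decomposes 0.
Proof.
exists [::], (fun _ => 0); split; rewrite ?big_nil // => j; exact: submod_zero.
Qed.

Lemma decomposesD u v : decomposes u -> decomposes v -> decomposes (u + v).
Proof.
move=> /decomposesP[s [w [us Gw w0 ->]]] /decomposesP[t [z [ut Gz z0 ->]]].
exists (undup (s ++ t)), (fun j => w j + z j); split; first exact: undup_uniq.
  by move=> j; apply: submodD.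
have sub1 : {subset s <= undup (s ++ t)}.
  by move=> j js; rewrite mem_undup mem_cat js.
have sub2 : {subset t <= undup (s ++ t)}.
  by move=> j js; rewrite mem_undup mem_cat js orbT.
rewrite big_split /= (sum_supp us (undup_uniq _) sub1 w0).
by rewrite (sum_supp ut (undup_uniq _) sub2 z0).
Qed.

Lemma decomposes_sum I (r : seq I) F :
  (forall i, decomposes (F i)) -> decomposes (\sum_(i <- r) F i).
Proof.
by move=> SF; apply: big_ind => //; [apply: decomposes_zero|apply: decomposesD].
Qed.

Lemma homog_decomposes j v : G j v -> decomposes v.
Proof.
move=> Gv; exists [:: j], (fun i => if i == j then v else 0); split => //.
  by move=> i; case: eqP => [->|_] //; apply: submod_zero.
by rewrite big_seq1 eqxx.
Qed.

Lemma independent_proj (pr : int -> {linear V -> V}) :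
  (forall i j v, G j v -> pr i v = if i == j then v else 0) -> independent.
Proof.
move=> prE s w us Gw sw0 j js; have := congr1 (pr j) sw0.
rewrite linear_sum linear0 (bigD1_seq j) //= (prE _ _ _ (Gw j)) eqxx.
rewrite big1 ?addr0 // => i ij; rewrite (prE _ _ _ (Gw i)) eq_sym.
by rewrite (negbTE ij).
Qed.
End Decomposition.

HB.mixin Record isGraded (R : comPzRingType) V of GRing.Lmodule R V := {
  gr : int -> submod V;
  gr_decomposes : forall v, decomposes gr v;
  gr_independent : independent gr }.

#[short(type="gradedModType")]
HB.structure Definition GradedModule (R : comPzRingType) :=
  { V of GRing.Lmodule R V & isGraded R V }.

Section GradedTheory.
Variables (R : comPzRingType) (V : gradedModType R).

Lemma gr_ext (W : lmodType R) (f g : {linear V -> W}) :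
  (forall j v, gr j v -> f v = g v) -> f =1 g.
Proof.
move=> fg v; have [s [w [_ Gw ->]]] := gr_decomposes v.
by rewrite !linear_sum; apply: eq_bigr => j _; apply: fg (Gw j).
Qed.

Lemma gr_sum_unique (s t : seq int) (w z : int -> V) : uniq s -> uniq t ->
  (forall j, gr j (w j)) -> (forall j, gr j (z j)) ->
  (forall j, j \notin s -> w j = 0) -> (forall j, j \notin t -> z j = 0) ->
  \sum_(j <- s) w j = \sum_(j <- t) z j -> w =1 z.
Proof.
move=> us ut Gw Gz w0 z0 e j.
have sub1 : {subset s <= undup (s ++ t)}.
  by move=> i js; rewrite mem_undup mem_cat js.
have sub2 : {subset t <= undup (s ++ t)}.
  by move=> i js; rewrite mem_undup mem_cat js orbT.
have [jst|] := boolP (j \in undup (s ++ t)); last first.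
  by rewrite mem_undup mem_cat negb_or => /andP[/w0-> /z0->].
have e0 : \sum_(i <- undup (s ++ t)) (w i + (-1) *: z i) = 0.
  rewrite big_split /= -scaler_sumr.
  rewrite (sum_supp us (undup_uniq _) sub1 w0) (sum_supp ut (undup_uniq _) sub2 z0).
  by rewrite e scaleN1r subrr.
have Gwz i : gr i (w i + (-1) *: z i).
  by apply: submodD => //; apply: submodZ.
have := gr_independent _ _ (undup_uniq _) Gwz e0 _ jst.
by rewrite scaleN1r => /subr0_eq.
Qed.

Lemma gr_proj_subproof : exists pr : int -> {linear V -> V},
  (forall j v, gr j (pr j v)) /\
  forall v, exists s, [/\ uniq s, forall j, j \notin s -> pr j v = 0
    & v = \sum_(j <- s) pr j v].
Proof.
have /choice[D DP] : forall v : V, exists p : seq int * (int -> V),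
    [/\ uniq p.1, forall j, gr j (p.2 j), forall j, j \notin p.1 -> p.2 j = 0
    & v = \sum_(j <- p.1) p.2 j].
  by move=> v; have [s [w ?]] := decomposesP (gr_decomposes v); exists (s, w).
have lD j : linear (fun v => (D v).2 j).
  move=> c u v; move: j.
  have [us Gw w0 ue] := DP u; have [ut Gz z0 ve] := DP v.
  have [ur Gx x0 e] := DP (c *: u + v).
  apply: (@gr_sum_unique (D (c *: u + v)).1 (undup ((D u).1 ++ (D v).1))) => //.
  - exact: undup_uniq.
  - by move=> j; apply: submod_lin.
  - move=> j; rewrite mem_undup mem_cat negb_or => /andP[/w0-> /z0->].
    by rewrite scaler0 addr0.
  - rewrite -e big_split /= -scaler_sumr.
    have sub1 : {subset (D u).1 <= undup ((D u).1 ++ (D v).1)}.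
      by move=> i js; rewrite mem_undup mem_cat js.
    have sub2 : {subset (D v).1 <= undup ((D u).1 ++ (D v).1)}.
      by move=> i js; rewrite mem_undup mem_cat js orbT.
    rewrite (sum_supp us (undup_uniq _) sub1 w0).
    by rewrite (sum_supp ut (undup_uniq _) sub2 z0) -ue -ve.
exists (fun j => mk_linear (lD j)); split => [j v|v] /=; first by have [] := DP v.
by exists (D v).1; have [] := DP v.
Qed.

Definition gr_proj : int -> {linear V -> V} := projT1 (cid gr_proj_subproof).
Lemma gr_projP j v : gr j (gr_proj j v).
Proof. by rewrite /gr_proj; case: cid => pr [] /=. Qed.
Lemma gr_proj_supp v : exists s, [/\ uniq s, forall j, j \notin s -> gr_proj j v = 0
    & v = \sum_(j <- s) gr_proj j v].
Proof. by rewrite /gr_proj; case: cid => pr [] /=. Qed.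
Lemma gr_projE i j v : gr j v -> gr_proj i v = if i == j then v else 0.
Proof.
move=> Gv; have [s [us w0 e]] := gr_proj_supp v.
apply: (@gr_sum_unique s [:: j] (fun i => gr_proj i v)
  (fun i => if i == j then v else 0)) => //.
- by move=> k; apply: gr_projP.
- by move=> k; case: eqP => [->|] // _; apply: submod_zero.
- by move=> k; rewrite inE => /negbTE ->.
- by rewrite -e big_seq1 eqxx.
Qed.

(* A family of linear maps, one per degree, glues to one linear map. *)
Lemma gr_glue (W : lmodType R) (F : int -> {linear V -> W}) :
  exists G : {linear V -> W}, forall j v, gr j v -> G v = F j v.
Proof.
have /choice[S SP] := gr_proj_supp.
have G_lin : linear (fun v => \sum_(j <- S v) F j (gr_proj j v)).
  move=> c u v /=.
  set T := undup (S u ++ S v ++ S (c *: u + v)).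
  have e x : {subset S x <= T} -> \sum_(j <- S x) F j (gr_proj j x)
      = \sum_(j <- T) F j (gr_proj j x).
    move=> sub; have [us w0 _] := SP x; rewrite (sum_supp us _ sub) //.
      exact: undup_uniq.
    by move=> j /w0 ->; rewrite linear0.
  rewrite !e; first by rewrite scaler_sumr -big_split; apply: eq_bigr => j _; rewrite !linearP.
  - by move=> j h; rewrite mem_undup !mem_cat h !orbT.
  - by move=> j h; rewrite mem_undup !mem_cat h.
  - by move=> j h; rewrite mem_undup !mem_cat h !orbT.
exists (mk_linear G_lin) => j v Gv /=.
have [us w0 e] := SP v.
have -> : \sum_(i <- S v) F i (gr_proj i v) = \sum_(i <- S v) F j (gr_proj i v).
  apply: eq_bigr => i _; rewrite (gr_projE _ Gv).
  by case: eqP => [->|] //; rewrite !linear0.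
by rewrite -linear_sum -e.
Qed.
End GradedTheory.

Arguments gr_proj {R V}.

Section GradedLift.
Variables (R : comPzRingType) (U : gradedModType R) (V W : lmodType R).
Variable B : int -> U -> V -> W.
Hypothesis Bl : forall i c u u' v, B i (c *: u + u') v = c *: B i u v + B i u' v.
Hypothesis Br : forall i c u v v', B i u (c *: v + v') = c *: B i u v + B i u v'.

Lemma gr_lift : exists G : {linear tensor U V -> W},
  forall i u v, gr i u -> G (u ⊗ v) = B i u v.
Proof.
have /choice[H HP] : forall v, exists H : {linear U -> W},
    forall i u, gr i u -> H u = B i u v.
  move=> v; have lB i : linear (fun u => B i u v) by move=> c u u'; apply: Bl.
  by have [H HP] := gr_glue (fun i => mk_linear (lB i)); exists H.
have Hr c u v v' : H (c *: v + v') u = c *: H v u + H v' u.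
  apply: (gr_ext (f := H (c *: v + v')) (g := c *: H v + H v')) => i {}u Gu.
  by rewrite /= (HP _ _ _ Gu) Br -!(HP _ _ _ Gu).
have [||G GP] := @tensor_lift _ U V W (fun u v => H v u).
- by move=> c u u' v; rewrite linearP.
- by move=> c u v v'; rewrite Hr.
- by exists G => i u v Gu; rewrite GP; apply: HP.
Qed.
End GradedLift.

Section GradedLift2.
Variables (R : comPzRingType) (U V : gradedModType R) (W : lmodType R).
Variable B : int -> int -> U -> V -> W.
Hypothesis Bl : forall i j c u u' v,
  B i j (c *: u + u') v = c *: B i j u v + B i j u' v.
Hypothesis Br : forall i j c u v v',
  B i j u (c *: v + v') = c *: B i j u v + B i j u v'.

Lemma gr_lift2 : exists G : {linear tensor U V -> W},
  forall i j u v, gr i u -> gr j v -> G (u ⊗ v) = B i j u v.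
Proof.
have /choice[H HP] : forall p : int * U, exists H : {linear V -> W},
    forall j v, gr j v -> H v = B p.1 j p.2 v.
  move=> [i u]; have lB j : linear (fun v => B i j u v) by move=> c v v'; apply: Br.
  by have [H HP] := gr_glue (fun j => mk_linear (lB j)); exists H.
have [||G GP] := @gr_lift _ U V W (fun i u v => H (i, u) v).
- move=> i c u u' v.
  apply: (gr_ext (f := H (i, c *: u + u')) (g := c *: H (i, u) + H (i, u'))).
  by move=> j {}v Gv; rewrite /= (HP _ _ _ Gv) /= Bl -!(HP (_, _) _ _ Gv).
- by move=> i c u v v'; rewrite linearP.
- by exists G => i j u v Gu Gv; rewrite (GP _ _ _ Gu) (HP _ _ _ Gv).
Qed.
End GradedLift2.

Section TensorGrading.
Variables (R : comPzRingType) (U V : gradedModType R).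

Definition tensor_deg (k : int) (x : tensor U V) := exists s : seq (U * V),
  (forall p, p \in s -> exists i j, [/\ i + j = k, gr i p.1 & gr j p.2]) /\
  x = \sum_(p <- s) p.1 ⊗ p.2.

Lemma tensor_deg_zero k : tensor_deg k 0.
Proof. by exists [::]; rewrite big_nil. Qed.
Lemma tensor_deg_lin k c x y :
  tensor_deg k x -> tensor_deg k y -> tensor_deg k (c *: x + y).
Proof.
move=> [s [hs ->]] [t [ht ->]].
exists ([seq (c *: p.1, p.2) | p <- s] ++ t); split.
  move=> p; rewrite mem_cat => /orP[/mapP[q /hs[i [j [e h1 h2]]] ->]|/ht //].
  by exists i, j; split => //; apply: submodZ.
rewrite big_cat big_map scaler_sumr /=; congr (_ + _).
by apply: eq_bigr => p _; rewrite tpairZl.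
Qed.
Definition tensor_gr k := Submod (tensor_deg_zero k) (@tensor_deg_lin k).

Lemma tensor_deg_pair i j u v : gr i u -> gr j v -> tensor_deg (i + j) (u ⊗ v).
Proof.
move=> Gu Gv; exists [:: (u, v)]; split; last by rewrite big_seq1.
by move=> p; rewrite inE => /eqP ->; exists i, j.
Qed.

Lemma tpair_suml I (r : seq I) F (v : V) :
  (\sum_(i <- r) F i : U) ⊗ v = \sum_(i <- r) F i ⊗ v.
Proof.
elim: r => [|i r IH]; first by rewrite !big_nil tpair0l.
by rewrite !big_cons tpairDl IH.
Qed.
Lemma tpair_sumr I (r : seq I) F (u : U) :
  u ⊗ (\sum_(i <- r) F i : V) = \sum_(i <- r) u ⊗ F i.
Proof.
elim: r => [|i r IH]; first by rewrite !big_nil tpair0r.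
by rewrite !big_cons tpairDr IH.
Qed.

Lemma tensor_gr_decomposes x : decomposes tensor_gr x.
Proof.
have [s ->] := tensor_span x; apply: decomposes_sum => -[u v] /=.
have [t [w [_ Gw ->]]] := gr_decomposes u.
have [r [z [_ Gz ->]]] := gr_decomposes v.
rewrite tpair_suml; apply: decomposes_sum => i.
rewrite tpair_sumr; apply: decomposes_sum => j.
by apply: (@homog_decomposes _ _ _ (i + j)); apply: tensor_deg_pair.
Qed.

Lemma tensor_gr_independent : independent tensor_gr.
Proof.
have /choice[pr prP] : forall k, exists G : {linear tensor U V -> tensor U V},
    forall i j u v, gr i u -> gr j v ->
      G (u ⊗ v) = if k == i + j then u ⊗ v else 0.
  move=> k; apply: (@gr_lift2 _ _ _ _
    (fun i j u v => if k == i + j then u ⊗ v else 0)) => i j c.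
    by move=> u u' v; case: eqP => _; rewrite ?tpairPl ?scaler0 ?addr0.
  by move=> u v v'; case: eqP => _; rewrite ?tpairPr ?scaler0 ?addr0.
apply: (@independent_proj _ _ _ pr) => k l x [s [hs ->]]; rewrite linear_sum.
rewrite [LHS]big_seq (eq_bigr (fun p => if k == l then p.1 ⊗ p.2 else 0)).
  by case: eqP => _; [rewrite -big_seq | rewrite big1].
by move=> p /hs[i [j [<- Gu Gv]]]; apply: prP.
Qed.

HB.instance Definition _ :=
  isGraded.Build R (tensor U V) tensor_gr_decomposes tensor_gr_independent.
End TensorGrading.

Section ScalarGrading.
Variable R : comPzRingType.
Definition scalar_deg (k : int) (c : R^o) := k != 0 -> c = 0.
Lemma scalar_deg_zero k : scalar_deg k 0. Proof. by []. Qed.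
Lemma scalar_deg_lin k c x y :
  scalar_deg k x -> scalar_deg k y -> scalar_deg k (c *: x + y).
Proof. by move=> hx hy k0; rewrite hx // hy // scaler0 addr0. Qed.
Definition scalar_gr k := Submod (@scalar_deg_zero k) (@scalar_deg_lin k).
Lemma scalar_gr_decomposes x : decomposes scalar_gr x.
Proof. exact: (@homog_decomposes _ _ _ 0). Qed.
Lemma scalar_gr_independent : independent scalar_gr.
Proof.
move=> s w us Gw sw j js; have [j0|j0] := eqVneq j 0; last exact: Gw.
move: sw; rewrite (bigD1_seq j) //= big1 ?addr0 // => i ij; apply: Gw.
by rewrite -j0.
Qed.
HB.instance Definition _ :=
  isGraded.Build R R^o scalar_gr_decomposes scalar_gr_independent.
End ScalarGrading.

Section GradedHom.
Variables (R : comPzRingType) (k : int) (U V : gradedModType R).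

Definition degree_map (f : {linear U -> V}) :=
  forall j u, gr j u -> gr (j + k) (f u).
Lemma degree_map_zero : degree_map 0.
Proof. by move=> j u _; apply: submod_zero. Qed.
Lemma degree_map_lin c f g :
  degree_map f -> degree_map g -> degree_map (c *: f + g).
Proof. by move=> hf hg j u Gu; apply: submod_lin; [apply: hf|apply: hg]. Qed.

Definition gHom := subm (Submod degree_map_zero degree_map_lin).
HB.instance Definition _ := GRing.Lmodule.on gHom.
Definition gHom_linear (f : gHom) : {linear U -> V} := subm_val f.
Coercion gHom_linear : gHom >-> GRing.Linear.type.
Definition mk_gHom (f : {linear U -> V}) (hf : degree_map f) : gHom :=
  mk_subm (S := Submod degree_map_zero degree_map_lin) hf.

Lemma gHom_deg (f : gHom) : degree_map f. Proof. exact: (submP f). Qed.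
End GradedHom.

Section Duals.
Variables (R : comPzRingType) (V : gradedModType R).
Implicit Types f g : {linear V -> R^o}.

(* A functional on the summand V_j is represented by its extension by zero. *)
Definition vanishes_off (j : int) f := forall i v, i != j -> gr i v -> f v = 0.
Lemma vanishes_off_zero j : vanishes_off j 0. Proof. by []. Qed.
Lemma vanishes_off_lin j c f g :
  vanishes_off j f -> vanishes_off j g -> vanishes_off j (c *: f + g).
Proof.
by move=> hf hg i v ij Gv; rewrite /= (hf _ _ ij Gv) (hg _ _ ij Gv) scaler0 addr0.
Qed.
Definition dual_submod j :=
  Submod (@vanishes_off_zero j) (@vanishes_off_lin j).

Definition dual_part (j : int) := subm (dual_submod j).
HB.instance Definition _ j := GRing.Lmodule.on (dual_part j).
Definition dual_part_linear j (f : dual_part j) : {linear V -> R^o} := subm_val f.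

Definition finite_functional f := exists s : seq int,
  forall j v, j \notin s -> gr j v -> f v = 0.
Lemma finite_functional_zero : finite_functional 0. Proof. by exists [::]. Qed.
Lemma finite_functional_lin c f g : finite_functional f ->
  finite_functional g -> finite_functional (c *: f + g).
Proof.
move=> [s hs] [t ht]; exists (s ++ t) => j v; rewrite mem_cat negb_or.
by move=> /andP[js jt] Gv; rewrite /= (hs _ _ js Gv) (ht _ _ jt Gv) scaler0 addr0.
Qed.

Definition gdual := subm (Submod finite_functional_zero finite_functional_lin).
HB.instance Definition _ := GRing.Lmodule.on gdual.
Definition gdual_linear (f : gdual) : {linear V -> R^o} := subm_val f.
Definition mk_gdual f (hf : finite_functional f) : gdual :=
  mk_subm (S := Submod finite_functional_zero finite_functional_lin) hf.

Definition gdual_deg (j : int) (f : gdual) := vanishes_off (- j) (gdual_linear f).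
Lemma gdual_deg_zero j : gdual_deg j 0. Proof. by []. Qed.
Lemma gdual_deg_lin j c (f g : gdual) :
  gdual_deg j f -> gdual_deg j g -> gdual_deg j (c *: f + g).
Proof. exact: vanishes_off_lin. Qed.
Definition gdual_gr j := Submod (@gdual_deg_zero j) (@gdual_deg_lin j).

Lemma gdual_sumE (I : Type) (r : seq I) (F : I -> gdual) v :
  gdual_linear (\sum_(i <- r) F i) v = \sum_(i <- r) gdual_linear (F i) v.
Proof.
elim: r => [|i r IH]; first by rewrite !big_nil.
by rewrite !big_cons -IH.
Qed.

Lemma gdual_gr_decomposes (f : gdual) : decomposes gdual_gr f.
Proof.
case: (submP f) => s hs.
have pr_deg j i v : i != j -> gr i v -> (gdual_linear f \o gr_proj j) v = 0.
  by move=> ij Gv; rewrite /= (gr_projE _ Gv) eq_sym (negbTE ij) linear0.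
have pr_fin j : finite_functional (gdual_linear f \o gr_proj j).
  by exists [:: j] => i v; rewrite inE; apply: pr_deg.
exists (undup (map -%R s)), (fun j => mk_gdual (pr_fin (- j))); split.
- exact: undup_uniq.
- by move=> j i v; apply: pr_deg.
- apply: val_inj; apply: linear_ext => v /=.
  rewrite -[RHS]/(gdual_linear _ v) gdual_sumE /=.
  have [t [ut w0 e]] := gr_proj_supp v.
  rewrite -[LHS]/(gdual_linear f v) {1}e linear_sum.
  rewrite -(big_map (fun j => - j) xpredT (fun j => gdual_linear f (gr_proj j v))) /=.
  set t' := map _ _.
  have ut' : uniq t' by rewrite map_inj_uniq ?undup_uniq //; exact: oppr_inj.
  have mt' j : (j \in t') = (j \in s).
    rewrite -[j]opprK /t' (mem_map oppr_inj) mem_undup (mem_map oppr_inj).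
    by rewrite !opprK.
  have us : uniq (undup (t ++ t')) by exact: undup_uniq.
  rewrite -(@sum_supp _ _ t _ (fun j => gdual_linear f (gr_proj j v)) ut us); first last.
  + by move=> j /w0 ->; rewrite linear0.
  + by move=> j h; rewrite mem_undup mem_cat h.
  apply: sum_supp => //.
  + by move=> j h; rewrite mem_undup mem_cat h orbT.
  + by move=> j; rewrite mt' => js; apply: (hs _ _ js); apply: gr_projP.
Qed.

Lemma gdual_gr_independent : independent gdual_gr.
Proof.
move=> s w us Gw sw j js; apply: val_inj; apply: linear_ext.
apply: gr_ext => i v Gv; rewrite -[LHS]/(gdual_linear (w j) v) [RHS]/=.
have [e|ij] := eqVneq i (- j); last exact: Gw ij Gv.
have := congr1 (fun g : gdual => gdual_linear g v) sw.
rewrite gdual_sumE (bigD1_seq j) //= big1 ?addr0 // => k kj.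
by apply: (Gw k _ _ _ Gv); rewrite e eqr_opp eq_sym.
Qed.

HB.instance Definition _ :=
  isGraded.Build R gdual gdual_gr_decomposes gdual_gr_independent.
End Duals.
Coercion dual_part_linear : dual_part >-> GRing.Linear.type.
Coercion gdual_linear : gdual >-> GRing.Linear.type.

Section TensorPower.
Variables (R : comPzRingType) (A : gradedModType R).

Fixpoint tpow (n : nat) : gradedModType R :=
  if n is n'.+1 then tensor A (tpow n') else R^o.

(* tens a i n is a_i ⊗ a_(i+1) ⊗ ... ⊗ a_(i+n-1). *)
Fixpoint tens (a : nat -> A) (i n : nat) : tpow n :=
  if n is n'.+1 then a i ⊗ tens a i.+1 n' else (1 : R^o).

(* The sequence a_1, ..., a_(i-1), x, a_(i+l), a_(i+l+1), ... *)
Definition splice (a : nat -> A) (i l : nat) (x : A) : nat -> A :=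
  fun q => if (q < i)%N then a q else if q == i then x else a (q + l - 1)%N.

Definition homog (d : nat -> int) (a : nat -> A) (n : nat) :=
  forall q, (1 <= q <= n)%N -> gr (d q) (a q).
End TensorPower.

Definition signz (R : pzRingType) (k : int) : R := (-1) ^+ `|k|%N.
Definition maltese (d : nat -> int) (i j : nat) : int :=
  \sum_(i <= q < j.+1) (d q - 1).
Notation "✠" := maltese.

Section Structures.
Variables (R : comPzRingType) (A : gradedModType R).

(* Only the operations mu n with 1 <= n are ever used. *)
Definition ainf_ops := forall n : nat, gHom (2 - n%:Z) (tpow A n) A.

Definition ainf_relation (mu : ainf_ops) :=
  forall (r : nat) (d : nat -> int) (a : nat -> A), (1 <= r)%N -> homog d a r ->
  \sum_(1 <= n1 < r.+1) \sum_(1 <= i < r.+2 - n1)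
    signz R (✠ d 1 i.-1) *:
      mu (r.+1 - n1)%N (tens (splice a i n1 (mu n1 (tens a i n1))) 1 (r.+1 - n1))
  = 0.

Record ainf_algebra := AinfAlgebra {
  ainf_mu :> ainf_ops;
  ainf_muP : ainf_relation ainf_mu }.

Definition bimod_ops (M : gradedModType R) := forall r s : nat,
  gHom (1 - r%:Z - s%:Z) (tensor (tensor (tpow A r) M) (tpow A s)) M.

Definition bimod_relation (mu : ainf_ops) (M : gradedModType R) (muM : bimod_ops M) :=
  forall (r s : nat) (d : nat -> int) (a : nat -> A) (dm : int) (m : M),
  homog d a (r + s) -> gr dm m ->
  \sum_(1 <= r2 < r.+2) \sum_(1 <= i < (r.+1 - r2).+1)
    signz R (✠ d 1 i.-1) *:
      muM (r.+1 - r2)%N s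
        (tens (splice a i r2 (mu r2 (tens a i r2))) 1 (r.+1 - r2)
           ⊗ m ⊗ tens a r.+1 s)
  + \sum_(0 <= r1 < r.+1) \sum_(0 <= s2 < s.+1)
    signz R (✠ d 1 r1) *:
      muM r1 (s - s2)%N
        (tens a 1 r1
           ⊗ muM (r - r1)%N s2 (tens a r1.+1 (r - r1) ⊗ m ⊗ tens a r.+1 s2)
           ⊗ tens a (r + s2).+1 (s - s2))
  + \sum_(1 <= s2 < s.+2) \sum_(1 <= j < (s.+1 - s2).+1)
    signz R (✠ d 1 (r + j).-1 + dm) *:
      muM r (s.+1 - s2)%N
        (tens a 1 r ⊗ m
           ⊗ tens (splice a (r + j) s2 (mu s2 (tens a (r + j) s2))) r.+1 (s.+1 - s2))
  = 0.

Record ainf_bimodule (mu : ainf_ops) (M : gradedModType R) := AinfBimodule {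
  bimod_mu :> bimod_ops M;
  bimod_muP : bimod_relation mu bimod_mu }.
End Structures.

Section MultilinearLift.
Variables (R : comPzRingType) (A : gradedModType R).
Implicit Types (a : nat -> A) (d : nat -> int) (W : lmodType R).

Definition upd (T : Type) (a : nat -> T) (q : nat) (x : T) : nat -> T :=
  fun k => if k == q then x else a k.

Definition lin_at W (q : nat) (F : (nat -> A) -> W) := forall a c x y,
  F (upd a q (c *: x + y)) = c *: F (upd a q x) + F (upd a q y).
Definition const_at (T : Type) (q : nat) (F : (nat -> A) -> T) :=
  forall a x y, F (upd a q x) = F (upd a q y).

Lemma upd_eq (T : Type) (a : nat -> T) q x : upd a q x q = x.
Proof. by rewrite /upd eqxx. Qed.
Lemma upd_neq (T : Type) (a : nat -> T) q x k : k != q -> upd a q x k = a k.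
Proof. by rewrite /upd => /negbTE ->. Qed.

Lemma tens_congr a a' i n :
  (forall q, (i <= q < i + n)%N -> a q = a' q) -> tens a i n = tens a' i n.
Proof.
elim: n i => [|n IH] i e //=; rewrite e; last by lia.
by congr (_ ⊗ _); apply: IH => q hq; apply: e; lia.
Qed.

Lemma tens_const q i n : ~~ (i <= q < i + n)%N -> const_at q (fun a => tens a i n).
Proof.
move=> hq a x y; apply: tens_congr => k hk.
by rewrite !upd_neq //; apply: contraNneq hq => <-.
Qed.

Lemma tens_lin q i n : (i <= q < i + n)%N -> lin_at q (fun a => tens a i n).
Proof.
elim: n i => [|n IH] i hq a c x y; first by lia.
rewrite /=; have [e|iq] := eqVneq i q.
  rewrite -e !upd_eq tpairPl; congr (_ *: (_ ⊗ _) + _ ⊗ _);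
    apply: tens_congr => k hk; rewrite !upd_neq //; lia.
rewrite !(upd_neq _ _ iq) IH ?tpairPr //.
by move: iq hq; lia.
Qed.

Lemma tens_ext n W (f g : {linear tpow A n -> W}) i :
  (forall d a, (forall q, (i <= q < i + n)%N -> gr (d q) (a q)) ->
    f (tens a i n) = g (tens a i n)) -> f =1 g.
Proof.
elim: n f g i => [|n IH] f g i fg x.
  have -> : x = (x : R^o) *: (1 : R^o) by rewrite /GRing.scale /= mulr1.
  rewrite !linearZ; congr (_ *: _).
  by apply: (fg (fun _ => 0) (fun _ => 0)) => q; lia.
apply: tensor_ext x => u v.
have fl u' : linear (fun v' => f (u' ⊗ v')) by move=> c y z; rewrite tpairPr linearP.
have gl u' : linear (fun v' => g (u' ⊗ v')) by move=> c y z; rewrite tpairPr linearP.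
have fl' v' : linear (fun u' => f (u' ⊗ v')) by move=> c y z; rewrite tpairPl linearP.
have gl' v' : linear (fun u' => g (u' ⊗ v')) by move=> c y z; rewrite tpairPl linearP.
apply: (gr_ext (f := mk_linear (fl' v)) (g := mk_linear (gl' v))) => j {}u Gu /=.
apply: (IH (mk_linear (fl u)) (mk_linear (gl u)) i.+1) => d a Ga /=.
have /= := fg (upd d i j) (upd a i u).
rewrite upd_eq (@tens_congr (upd a i u) a); last first.
  by move=> q hq; rewrite upd_neq //; lia.
apply=> q hq; rewrite /upd; case: eqP => [_|/eqP qi] //; apply: Ga.
by move: qi hq; lia.
Qed.

Lemma tens_lift n i W (F : (nat -> int) -> (nat -> A) -> W) :
  (forall d d' a a',
    (forall q, (i <= q < i + n)%N -> d q = d' q /\ a q = a' q) ->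
    F d a = F d' a') ->
  (forall d q, (i <= q < i + n)%N -> lin_at q (F d)) ->
  exists G : {linear tpow A n -> W}, forall d a,
    (forall q, (i <= q < i + n)%N -> gr (d q) (a q)) -> G (tens a i n) = F d a.
Proof.
elim: n i F => [|n IH] i F Floc Flin.
  have l : linear (fun r : R^o => (r : R) *: F (fun=> 0) (fun=> 0)).
    by move=> c x y; rewrite scalerDl scalerA.
  exists (mk_linear l) => d a _ /=; rewrite scale1r.
  by apply: Floc => q; lia.
have /choice[G GP] : forall p : int * A, exists G : {linear tpow A n -> W},
    forall d a, (forall q, (i.+1 <= q < i.+1 + n)%N -> gr (d q) (a q)) ->
    G (tens a i.+1 n) = F (upd d i p.1) (upd a i p.2).
  move=> [k x] /=; apply: (IH i.+1 (fun d a => F (upd d i k) (upd a i x))).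
    move=> d d' a a' e; apply: Floc => q hq; rewrite /upd.
    by case: eqP => // /eqP qi; apply: e; move: qi hq; lia.
  move=> d q hq b c y z.
  have sw w : upd (upd b q w) i x = upd (upd b i x) q w.
    apply: funext => k'; rewrite /upd.
    by case: eqP => // ->; case: eqP => // e; move: hq; lia.
  by rewrite !sw Flin //; lia.
have [| |H HP] := @gr_lift _ A (tpow A n) W (fun k x t => G (k, x) t).
- move=> k c x y t; apply: (@tens_ext _ _ (G (k, c *: x + y))
    (c *: G (k, x) + G (k, y)) i.+1) => d a Ga.
  by rewrite /= !(GP _ _ _ Ga) /= Flin //; lia.
- by move=> k c x y z; rewrite linearP.
exists H => d a Ga /=.
rewrite (HP (d i)); last by apply: Ga; lia.
rewrite (GP _ d); last by move=> q hq; apply: Ga; lia.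
by apply: Floc => q _; rewrite /upd; case: eqP => [->|].
Qed.

(* The same with one more argument, in front. *)
Lemma tens_lift1 (M : gradedModType R) n i W
    (F : int -> M -> (nat -> int) -> (nat -> A) -> W) :
  (forall k m d d' a a',
    (forall q, (i <= q < i + n)%N -> d q = d' q /\ a q = a' q) ->
    F k m d a = F k m d' a') ->
  (forall k m d q, (i <= q < i + n)%N -> lin_at q (F k m d)) ->
  (forall k c m m' d a, F k (c *: m + m') d a = c *: F k m d a + F k m' d a) ->
  exists G : {linear tensor M (tpow A n) -> W}, forall k m d a, gr k m ->
    (forall q, (i <= q < i + n)%N -> gr (d q) (a q)) ->
    G (m ⊗ tens a i n) = F k m d a.
Proof.
move=> Floc Flin Fm.
have /choice[G GP] : forall p : int * M, exists G : {linear tpow A n -> W},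
    forall d a, (forall q, (i <= q < i + n)%N -> gr (d q) (a q)) ->
    G (tens a i n) = F p.1 p.2 d a.
  by move=> p; apply: tens_lift; [apply: Floc | apply: Flin].
have [| |H HP] := @gr_lift _ M (tpow A n) W (fun k x t => G (k, x) t).
- move=> k c x y t; apply: (@tens_ext _ _ (G (k, c *: x + y))
    (c *: G (k, x) + G (k, y)) i) => d a Ga.
  by rewrite /= !(GP _ _ _ Ga) /= Fm.
- by move=> k c x y z; rewrite linearP.
exists H => k m d a Gm Ga; rewrite (HP k) //; exact: GP.
Qed.

Section LinAt.
Variables (W W' : lmodType R) (q : nat).
Lemma lin_at_comp (f : {linear W -> W'}) F : lin_at q F -> lin_at q (fun a => f (F a)).
Proof. by move=> h a c x y; rewrite h linearP. Qed.
Lemma const_at_comp (T T' : Type) (f : T -> T') F :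
  const_at q F -> const_at q (fun a => f (F a)).
Proof. by move=> h a x y; rewrite (h a x y). Qed.
Lemma lin_at_pairl F F' : lin_at q F -> const_at q F' ->
  lin_at q (fun a => (F a : W) ⊗ (F' a : W')).
Proof.
move=> h h' a c x y; rewrite h tpairPl (h' a (c *: x + y) y); congr (_ *: (_ ⊗ _) + _).
exact: h'.
Qed.
Lemma lin_at_pairr F F' : const_at q F -> lin_at q F' ->
  lin_at q (fun a => (F a : W) ⊗ (F' a : W')).
Proof.
move=> h h' a c x y; rewrite h' tpairPr (h a (c *: x + y) y); congr (_ *: (_ ⊗ _) + _).
exact: h.
Qed.
Lemma const_at_pair F F' : const_at q F -> const_at q F' ->
  const_at q (fun a => (F a : W) ⊗ (F' a : W')).
Proof. by move=> h h' a x y; rewrite (h a x y) (h' a x y). Qed.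
Lemma const_at_cst (T : Type) (w : T) : const_at q (fun _ => w).
Proof. by []. Qed.
Lemma lin_at_scale c F : lin_at q F -> lin_at q (fun a => c *: (F a : W)).
Proof.
move=> h a b x y; rewrite h scalerDr !scalerA; congr (_ + _).
by rewrite mulrC.
Qed.
Lemma lin_at_add F F' : lin_at q F -> lin_at q F' ->
  lin_at q (fun a => (F a : W) + F' a).
Proof. by move=> h h' a b x y; rewrite h h' scalerDr addrACA. Qed.
Lemma lin_at_sum (m n : nat) F : (forall k, (m <= k < n)%N -> lin_at q (F k)) ->
  lin_at q (fun a => \sum_(m <= k < n) (F k a : W)).
Proof.
move=> h a b x y; rewrite scaler_sumr -big_split /=.
by apply: eq_big_nat => k hk; apply: h.
Qed.
End LinAt.

Lemma splice_lin (l p i n q : nat) (g : {linear tpow A l -> A}) :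
  (1 <= l)%N -> (i <= p < i + n)%N -> (i <= q < i + n + l - 1)%N ->
  lin_at q (fun a => tens (splice a p l (g (tens a p l))) i n).
Proof.
move=> l1 hp hq a c x y.
have [qp|pq] := ltnP q p.
  have e z : tens (splice (upd a q z) p l (g (tens (upd a q z) p l))) i n
      = tens (upd (splice a p l (g (tens a p l))) q z) i n.
    rewrite (_ : tens (upd a q z) p l = tens a p l); last first.
      by apply: tens_congr => k hk; rewrite upd_neq //; lia.
    apply: tens_congr => k hk; rewrite /splice /upd.
    by do ![case: ifP => //]; lia.
  by rewrite !e tens_lin //; lia.
have [ql|lq] := ltnP q (p + l).
  have e z : tens (splice (upd a q z) p l (g (tens (upd a q z) p l))) i n
      = tens (upd (splice a p l 0) p (g (tens (upd a q z) p l))) i n.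
    apply: tens_congr => k hk; rewrite /splice /upd.
    by do ![case: ifP => //]; lia.
  by rewrite !e tens_lin ?linearP ?tens_lin ?linearP //; lia.
have e z : tens (splice (upd a q z) p l (g (tens (upd a q z) p l))) i n
    = tens (upd (splice a p l (g (tens a p l))) (q - l).+1 z) i n.
  rewrite (_ : tens (upd a q z) p l = tens a p l); last first.
    by apply: tens_congr => k hk; rewrite upd_neq //; lia.
  apply: tens_congr => k hk; rewrite /splice /upd.
  by do ![case: ifP => //]; lia.
by rewrite !e tens_lin //; lia.
Qed.

Lemma splice_congr (l p i n : nat) (g : tpow A l -> A) a a' :
  (1 <= l)%N -> (i <= p < i + n)%N ->
  (forall q, (i <= q < i + n + l - 1)%N -> a q = a' q) ->
  tens (splice a p l (g (tens a p l))) i n = tens (splice a' p l (g (tens a' p l))) i n.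
Proof.
move=> l1 hp e; rewrite (@tens_congr a a' p l); last by move=> q hq; apply: e; lia.
apply: tens_congr => k hk; rewrite /splice.
by do ![case: ifP => //] => *; apply: e; lia.
Qed.

Lemma maltese_congr d d' i j : (forall q, (i <= q <= j)%N -> d q = d' q) ->
  ✠ d i j = ✠ d' i j.
Proof. by move=> e; apply: eq_big_nat => q hq; rewrite e. Qed.

Lemma tens_gr d a i n : (forall q, (i <= q < i + n)%N -> gr (d q) (a q)) ->
  gr (\sum_(i <= q < i + n) d q) (tens a i n).
Proof.
elim: n i => [|n IH] i Ga.
  by rewrite addn0 big_geq // => /=.
rewrite big_ltn; last by lia.
rewrite addnS -addSn /=; apply: tensor_deg_pair; first by apply: Ga; lia.
by apply: IH => q hq; apply: Ga; lia.
Qed.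

Lemma tensor_homog (U V : gradedModType R) W (S : int -> submod W)
    (f : {linear tensor U V -> W}) :
  (forall i j u v, gr i u -> gr j v -> S (i + j) (f (u ⊗ v))) ->
  forall k x, gr k x -> S k (f x).
Proof.
move=> h l x [s [hs ->]]; rewrite linear_sum; apply: submod_sum_seq => p ps.
by have [i [j [<- Gu Gv]]] := hs _ ps; apply: h.
Qed.

Lemma tens_homog n i W (S : int -> submod W) (f : {linear tpow A n -> W}) :
  (forall d a, (forall q, (i <= q < i + n)%N -> gr (d q) (a q)) ->
    S (\sum_(i <= q < i + n) d q) (f (tens a i n))) ->
  forall k x, gr k x -> S k (f x).
Proof.
elim: n i S f => [|n IH] i S f h.
  move=> j x Gx; have [j0|/Gx ->] := eqVneq j 0; last by rewrite linear0; apply: submod_zero.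
  have -> : x = (x : R^o) *: (1 : R^o) by rewrite /GRing.scale /= mulr1.
  rewrite linearZ; apply: submodZ; rewrite j0.
  have := h (fun _ => 0) (fun _ => 0); rewrite addn0 big_geq //; apply=> q hq.
  exact: submod_zero.
apply: tensor_homog => j l u v Gu Gv.
have fl : linear (fun v' => f (u ⊗ v')) by move=> c y z; rewrite tpairPr linearP.
apply: (IH i.+1 (fun l => S (j + l)) (mk_linear fl)) Gv => d a Ga /=.
have := h (upd d i j) (upd a i u); rewrite (@big_ltn _ _ _ i (i + n.+1)); last by lia.
rewrite /= !upd_eq (@tens_congr (upd a i u) a); last first.
  by move=> q hq; rewrite upd_neq //; lia.
rewrite -addSnnS (@eq_big_nat _ _ _ _ _ _ d); last first.
  by move=> q hq; rewrite upd_neq //; lia.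
apply=> q hq; rewrite /upd; case: eqP => [_|/eqP qi] //; apply: Ga.
by move: qi hq; lia.
Qed.

Lemma tens1_homog (M : gradedModType R) n i W (S : int -> submod W)
    (f : {linear tensor M (tpow A n) -> W}) :
  (forall l m d a, gr l m -> (forall q, (i <= q < i + n)%N -> gr (d q) (a q)) ->
    S (l + \sum_(i <= q < i + n) d q) (f (m ⊗ tens a i n))) ->
  forall k x, gr k x -> S k (f x).
Proof.
move=> h; apply: tensor_homog => j l u v Gu Gv.
have fl : linear (fun v' => f (u ⊗ v')) by move=> c y z; rewrite tpairPr linearP.
apply: (tens_homog (i := i) (S := fun l => S (j + l)) (f := mk_linear fl)) Gv => d a Ga /=.
exact: h.
Qed.

Lemma tens1_ext (M : gradedModType R) n i W (f g : {linear tensor M (tpow A n) -> W}) :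
  (forall l m d a, gr l m -> (forall q, (i <= q < i + n)%N -> gr (d q) (a q)) ->
    f (m ⊗ tens a i n) = g (m ⊗ tens a i n)) -> f =1 g.
Proof.
move=> fg; apply: tensor_ext => u v.
have fl u' : linear (fun v' => f (u' ⊗ v')) by move=> c y z; rewrite tpairPr linearP.
have gl u' : linear (fun v' => g (u' ⊗ v')) by move=> c y z; rewrite tpairPr linearP.
have fl' v' : linear (fun u' => f (u' ⊗ v')) by move=> c y z; rewrite tpairPl linearP.
have gl' v' : linear (fun u' => g (u' ⊗ v')) by move=> c y z; rewrite tpairPl linearP.
apply: (gr_ext (f := mk_linear (fl' v)) (g := mk_linear (gl' v))) => j {}u Gu /=.
apply: (@tens_ext _ _ (mk_linear (fl u)) (mk_linear (gl u)) i) => d a Ga /=.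
exact: fg Gu Ga.
Qed.
End MultilinearLift.

Section TensorGradedExt.
Variables (R : comPzRingType) (U V : gradedModType R) (W : lmodType R).

Lemma tensor_gr_ext (f g : {linear tensor U V -> W}) :
  (forall i j u v, gr i u -> gr j v -> f (u ⊗ v) = g (u ⊗ v)) -> f =1 g.
Proof.
move=> fg; apply: gr_ext => k x [s [hs ->]]; rewrite !linear_sum.
apply: eq_big_seq => p /hs[i [j [_ Gu Gv]]]; exact: fg Gu Gv.
Qed.

Lemma tensor_gr_ind (S : submod W) (f : {linear tensor U V -> W}) :
  (forall i j u v, gr i u -> gr j v -> S (f (u ⊗ v))) -> forall x, S (f x).
Proof.
move=> h x; have [s [w [_ Gw ->]]] := gr_decomposes x.
rewrite linear_sum; apply: submod_sum => k _; have [r [hr ->]] := Gw k.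
rewrite linear_sum; apply: submod_sum_seq => p /hr[i [j [_ Gu Gv]]].
exact: h Gu Gv.
Qed.
End TensorGradedExt.

Lemma malteseE (d : nat -> int) i j :
  (i <= j.+1)%N -> ✠ d i j = \sum_(i <= q < j.+1) d q - (j.+1 - i)%N%:Z.
Proof.
move=> ij; rewrite /maltese sumrB; congr (_ - _).
by rewrite big_const_nat iter_addr_0 -mulr_natr mul1r natz.
Qed.

Section DualBimodule.
Variables (R : comPzRingType) (A M : gradedModType R).

Definition is_dual_ops (muM : bimod_ops A M) (muD : bimod_ops A (gdual M)) :=
  forall (r s : nat) (d : nat -> int) (a : nat -> A)
    (dp : int) (p : gdual M) (dm : int) (m : M),
  homog d a (r + s) -> gr dp p -> gr dm m ->
  (muD r s (tens a 1 r ⊗ p ⊗ tens a r.+1 s) : gdual M) m =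
  signz R (✠ d 1 r * (✠ d r.+1 (r + s) + dp + dm) + dp + 1) *
    p (muM s r (tens a r.+1 s ⊗ m ⊗ tens a 1 r)).

Lemma dual_op_tensor (muM : bimod_ops A M) r s :
  exists D : gHom (1 - r%:Z - s%:Z)
      (tensor (tensor (tpow A r) (gdual M)) (tpow A s)) (gdual M),
  forall i x j (p : gdual M) k y l m, gr i x -> gr j p -> gr k y -> gr l m ->
  (D (x ⊗ p ⊗ y) : gdual M) m =
  signz R ((i - r%:Z) * (k - s%:Z + j + l) + j + 1) * p (muM s r (y ⊗ m ⊗ x)).
Proof.
pose sg (i j k l : int) := signz R ((i - r%:Z) * (k - s%:Z + j + l) + j + 1).
have /choice[T TP] : forall z : int * int * int * tpow A r * gdual M * tpow A s,
    exists T : {linear M -> R^o}, forall l m, gr l m ->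
    let: (i, j, k, x, p, y) := z in
    T m = sg i j k l *: p (muM s r (y ⊗ m ⊗ x)).
  move=> [[[[[i j] k] x] p] y].
  have F_lin l : linear (fun m : M => sg i j k l *: (p (muM s r (y ⊗ m ⊗ x)) : R^o)).
    by move=> c m m'; rewrite tpairPr tpairPl !linearP.
  have [T TP] := gr_glue (fun l => mk_linear (F_lin l)).
  by exists T => l m Gm; rewrite (TP _ _ Gm).
have {}TP i j k x (p : gdual M) y l m : gr l m ->
    T (i, j, k, x, p, y) m = sg i j k l *: (p (muM s r (y ⊗ m ⊗ x)) : R^o).
  exact: (TP (i, j, k, x, p, y)).
have Tx i j k c x x' p y : T (i, j, k, c *: x + x', p, y)
    = c *: T (i, j, k, x, p, y) + T (i, j, k, x', p, y).
  apply: linear_ext; apply: gr_ext => l m Gm; rewrite /= !(TP _ _ _ _ _ _ _ _ Gm).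
  by rewrite tpairPr !linearP.
have Tp i j k c x p p' y : T (i, j, k, x, c *: p + p', y)
    = c *: T (i, j, k, x, p, y) + T (i, j, k, x, p', y).
  apply: linear_ext; apply: gr_ext => l m Gm; rewrite /= !(TP _ _ _ _ _ _ _ _ Gm).
  rewrite -[gdual_linear (c *: p + p') _]/(c *: (gdual_linear p _ : R^o) + gdual_linear p' _) scalerDr !scalerA.
  by rewrite [sg _ _ _ _ * c]mulrC.
have Ty i j k c x p y y' : T (i, j, k, x, p, c *: y + y')
    = c *: T (i, j, k, x, p, y) + T (i, j, k, x, p, y').
  apply: linear_ext; apply: gr_ext => l m Gm; rewrite /= !(TP _ _ _ _ _ _ _ _ Gm).
  by rewrite 2!tpairPl !linearP.
have /choice[H HP] : forall z : int * tpow A s,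
    exists H : {linear tensor (tpow A r) (gdual M) -> {linear M -> R^o}},
    forall i j x p, gr i x -> gr j p -> H (x ⊗ p) = T (i, j, z.1, x, p, z.2).
  move=> [k y] /=; apply: (@gr_lift2 _ _ _ _ (fun i j x p => T (i, j, k, x, p, y))).
    by move=> i j c x x' p; apply: Tx.
  by move=> i j c x p p'; apply: Tp.
have [| |D DP] := @gr_lift2 _ (tensor (tpow A r) (gdual M)) (tpow A s)
    {linear M -> R^o} (fun _ k X y => H (k, y) X).
- by move=> _ k c X X' y; rewrite linearP.
- move=> _ k c X y y'.
  apply: (@tensor_gr_ext _ _ _ _ (H (k, c *: y + y')) (c *: H (k, y) + H (k, y'))).
  by move=> i j x p Gx Gp; rewrite /= !(HP _ _ _ _ _ Gx Gp) /= Ty.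
have {}DP i x j (p : gdual M) k y l m : gr i x -> gr j p -> gr k y -> gr l m ->
    D (x ⊗ p ⊗ y) m = sg i j k l * p (muM s r (y ⊗ m ⊗ x)).
  move=> Gx Gp Gy Gm.
  rewrite (DP (i + j) k) //; last exact: tensor_deg_pair.
  by rewrite (HP _ _ _ _ _ Gx Gp) (TP _ _ _ _ _ _ _ _ Gm).
have Doff i x j p k y : gr i x -> gr j p -> gr k y ->
    vanishes_off (- (i + j + k + (1 - r%:Z - s%:Z))) (D (x ⊗ p ⊗ y)).
  move=> Gx Gp Gy l m hl Gm; rewrite (DP _ _ _ _ _ _ _ _ Gx Gp Gy Gm).
  have Gw : gr (k + l + i + (1 - s%:Z - r%:Z)) (muM s r (y ⊗ m ⊗ x)).
    apply: gHom_deg; apply: tensor_deg_pair => //; exact: tensor_deg_pair.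
  rewrite (Gp _ _ _ Gw) ?mulr0 //; apply: contraNneq hl => e.
  apply/eqP; lia.
have fl y : linear (fun X => D (X ⊗ y)) by move=> c X X'; rewrite tpairPl linearP.
have Dfin X : finite_functional (D X).
  apply: (@tensor_gr_ind _ _ _ _ (Submod (@finite_functional_zero _ M)
    (@finite_functional_lin _ M)) D) => _ k X' y _ Gy.
  apply: (@tensor_gr_ind _ _ _ _ (Submod (@finite_functional_zero _ M)
    (@finite_functional_lin _ M)) (mk_linear (fl y))) => i j x p Gx Gp /=.
  exists [:: - (i + j + k + (1 - r%:Z - s%:Z))] => l m; rewrite inE.
  exact: Doff.
have D'lin : linear (fun X => mk_gdual (Dfin X)).
  by move=> c X Y; apply: val_inj; rewrite /= linearP.
pose D' := mk_linear D'lin.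
have D'deg : degree_map (1 - r%:Z - s%:Z) D'.
  apply: (@tensor_homog _ _ _ _ (fun l => gr (l + (1 - r%:Z - s%:Z)))) => l k X y [w [hw ->]] Gy.
  have fl' : linear (fun X => D' (X ⊗ y)) by move=> c Z Z'; rewrite tpairPl linearP.
  rewrite -[D' _]/(mk_linear fl' _) linear_sum; apply: submod_sum_seq => q qw.
  have [i [j [<- Gx Gp]]] := hw _ qw; exact: Doff Gx Gp Gy.
exists (mk_gHom D'deg) => i x j p k y l m; exact: DP.
Qed.

Lemma dual_ops_exist (muM : bimod_ops A M) : exists muD, is_dual_ops muM muD.
Proof.
exists (fun r s => projT1 (cid (dual_op_tensor muM r s))).
move=> r s d a dp p dm m Ga Gp Gm; case: cid => D /= DP.
have Gx : gr (\sum_(1 <= q < 1 + r) d q) (tens a 1 r).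
  by apply: tens_gr => q hq; apply: Ga; lia.
have Gy : gr (\sum_(r.+1 <= q < r.+1 + s) d q) (tens a r.+1 s).
  by apply: tens_gr => q hq; apply: Ga; lia.
rewrite (DP _ _ _ _ _ _ _ _ Gx Gp Gy Gm); congr (signz R _ * _).
rewrite !malteseE; [|lia|lia]; rewrite add1n addSn subn1 /=.
by rewrite (_ : (r + s).+1 - r.+1 = s)%N //; lia.
Qed.

Definition dual_ops (muM : bimod_ops A M) : bimod_ops A (gdual M) :=
  projT1 (cid (dual_ops_exist muM)).
Lemma dual_opsP (muM : bimod_ops A M) : is_dual_ops muM (dual_ops muM).
Proof. exact: projT2 (cid (dual_ops_exist muM)). Qed.
End DualBimodule.

Section HochschildChains.
Variables (R : comPzRingType) (A M : gradedModType R).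

Let CHn (n : nat) : gradedModType R := tensor M (tpow A n).

Definition finite_support (x : dprod CHn) :=
  exists N : nat, forall n, (N <= n)%N -> x n = 0.
Lemma finite_support_zero : finite_support 0. Proof. by exists 0%N. Qed.
Lemma finite_support_lin c x y :
  finite_support x -> finite_support y -> finite_support (c *: x + y).
Proof.
move=> [N hN] [N' hN']; exists (maxn N N') => n; rewrite geq_max => /andP[h h'].
by rewrite dprod_addE dprod_scaleE hN // hN' // scaler0 addr0.
Qed.

(* CH_*(A;M), the direct sum of the M ⊗ A^{⊗n}. *)
Definition CH := subm (Submod finite_support_zero finite_support_lin).
HB.instance Definition _ := GRing.Lmodule.on CH.
Definition chain_comp (x : CH) (n : nat) : tensor M (tpow A n) := subm_val x n.

Definition chain_seq n (t : tensor M (tpow A n)) : dprod CHn := fun k =>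
  if n =P k is ReflectT e then eq_rect n (fun k => tensor M (tpow A k)) t k e else 0.
Lemma chain_seq_eq n t : @chain_seq n t n = t.
Proof. by rewrite /chain_seq; case: eqP => // e; rewrite (eq_axiomK e). Qed.
Lemma chain_seq_neq n t k : n != k -> @chain_seq n t k = 0.
Proof. by rewrite /chain_seq; case: eqP. Qed.
Lemma chain_seq_supp n t : finite_support (@chain_seq n t).
Proof. by exists n.+1 => k nk; rewrite chain_seq_neq //; lia. Qed.

(* The inclusion of the n-th summand. *)
Definition chain n (t : tensor M (tpow A n)) : CH :=
  mk_subm (S := Submod finite_support_zero finite_support_lin) (chain_seq_supp t).

Lemma CH_eq (x y : CH) : (forall n, chain_comp x n = chain_comp y n) -> x = y.
Proof.
by move=> e; apply: val_inj; apply: functional_extensionality_dep => n; exact: e.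
Qed.
Lemma chain_compD x y n : chain_comp (x + y) n = chain_comp x n + chain_comp y n.
Proof. by []. Qed.
Lemma chain_compZ c x n : chain_comp (c *: x) n = c *: chain_comp x n.
Proof. by []. Qed.
Lemma chain_comp_lin n : linear (fun x => chain_comp x n). Proof. by []. Qed.
Lemma chain_comp_sum I (r : seq I) (F : I -> CH) n :
  chain_comp (\sum_(i <- r) F i) n = \sum_(i <- r) chain_comp (F i) n.
Proof. exact: (linear_sum (mk_linear (@chain_comp_lin n))). Qed.
Lemma chain_compE n t : chain_comp (@chain n t) n = t.
Proof. exact: chain_seq_eq. Qed.
Lemma chain_comp0 n t k : n != k -> chain_comp (@chain n t) k = 0.
Proof. exact: chain_seq_neq. Qed.

Lemma chain_lin n : linear (@chain n).
Proof.
move=> c x y; apply: CH_eq => k; rewrite chain_compD chain_compZ.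
have [<-|nk] := eqVneq n k; first by rewrite !chain_compE.
by rewrite !chain_comp0 // scaler0 addr0.
Qed.

Lemma chain_sum (x : CH) : exists N : nat,
  x = \sum_(n < N) chain (chain_comp x n).
Proof.
have [N hN] := submP x; exists N; apply: CH_eq => k; rewrite chain_comp_sum.
have [kN|Nk] := ltnP k N; last first.
  rewrite [LHS]hN // big1 // => i _; rewrite chain_comp0 //.
  by have := ltn_ord i; lia.
rewrite (bigD1 (Ordinal kN)) // big1 => [|i ik]; last by rewrite chain_comp0.
by rewrite [RHS]addr0 -[RHS]/(chain_comp (chain (chain_comp x k)) k) chain_compE.
Qed.

Definition CH_deg (j : int) (x : CH) := forall n, gr (n%:Z - j) (chain_comp x n).
Lemma CH_deg_zero j : CH_deg j 0. Proof. by move=> n; apply: submod_zero. Qed.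
Lemma CH_deg_lin j c x y : CH_deg j x -> CH_deg j y -> CH_deg j (c *: x + y).
Proof. by move=> hx hy n; apply: (submod_lin c (hx n) (hy n)). Qed.
Definition CH_gr j := Submod (@CH_deg_zero j) (@CH_deg_lin j).

Lemma chain_deg n t j : gr (n%:Z - j) t -> CH_gr j (@chain n t).
Proof.
move=> Gt k; have [<-|nk] := eqVneq n k; first by rewrite chain_compE.
by rewrite chain_comp0 //; apply: submod_zero.
Qed.

Lemma CH_gr_decomposes x : decomposes CH_gr x.
Proof.
have [N ->] := chain_sum x; rewrite -(big_mkord xpredT (fun n => chain (chain_comp x n))).
apply: decomposes_sum => n; have [s [w [_ Gw ->]]] := gr_decomposes (chain_comp x n).
rewrite -[chain _]/(mk_linear (@chain_lin n) _) linear_sum /=.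
apply: decomposes_sum => i; apply: (@homog_decomposes _ _ _ (n%:Z - i)).
by apply: chain_deg; rewrite subKr.
Qed.

Lemma CH_gr_independent : independent CH_gr.
Proof.
move=> s w us Gw sw j js; apply: CH_eq => n.
have inj : injective (fun j => n%:Z - j) by move=> x y /addrI/oppr_inj.
have us' : uniq (map (fun j => n%:Z - j) s) by rewrite map_inj_uniq.
have Gw' k : gr k (chain_comp (w (n%:Z - k)) n).
  by have := Gw (n%:Z - k) n; rewrite subKr.
have sw' : \sum_(k <- map (fun j => n%:Z - j) s) chain_comp (w (n%:Z - k)) n = 0.
  rewrite big_map -[RHS]/(chain_comp 0 n) -sw chain_comp_sum.
  by apply: eq_bigr => i _; rewrite subKr.
have := gr_independent _ _ us' Gw' sw' (n%:Z - j).
by rewrite subKr; apply; apply/mapP; exists j.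
Qed.

HB.instance Definition _ := isGraded.Build R CH CH_gr_decomposes CH_gr_independent.

Lemma CH_lift (W : lmodType R) (f : forall n, {linear tensor M (tpow A n) -> W}) :
  exists G : {linear CH -> W}, forall n t, G (chain t) = f n t.
Proof.
have /choice[N NP] : forall x : CH, exists N, forall n, (N <= n)%N -> chain_comp x n = 0.
  by move=> x; have [N hN] := submP x; exists N.
have eN K x : (N x <= K)%N ->
    \sum_(0 <= n < K) f n (chain_comp x n) = \sum_(0 <= n < N x) f n (chain_comp x n).
  move=> h; rewrite (big_cat_nat _ h) //= [X in _ + X]big1_seq ?addr0 //.
  by move=> n /=; rewrite mem_index_iota => /andP[hn _]; rewrite NP ?linear0.
have G_lin : linear (fun x => \sum_(0 <= n < N x) f n (chain_comp x n)).
  move=> c x y; set K := maxn (N (c *: x + y)) (maxn (N x) (N y)).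
  rewrite -!(eN K) ?leq_max ?leqnn ?orbT // scaler_sumr -big_split.
  by apply: eq_bigr => n _; rewrite chain_compD chain_compZ linearP.
exists (mk_linear G_lin) => n t /=.
have hn : n \in index_iota 0 (maxn n.+1 (N (chain t))).
  by rewrite mem_index_iota leq_max ltnSn.
rewrite -(eN (maxn n.+1 (N (chain t)))) ?leq_maxr // (bigD1_seq n) ?iota_uniq //.
rewrite big1 => [|i ni]; last by rewrite chain_comp0 ?linear0 // eq_sym.
by rewrite [LHS]addr0 chain_compE.
Qed.

Lemma CH_ext (W : lmodType R) (f g : {linear CH -> W}) :
  (forall n d a dm m, homog d a n -> gr dm m ->
    f (chain (m ⊗ tens a 1 n)) = g (chain (m ⊗ tens a 1 n))) -> f =1 g.
Proof.
move=> fg x; have [N ->] := chain_sum x; rewrite !linear_sum.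
apply: eq_bigr => i _.
have fl : linear (fun t => f (@chain i t)) by move=> c y z; rewrite chain_lin linearP.
have gl : linear (fun t => g (@chain i t)) by move=> c y z; rewrite chain_lin linearP.
apply: (@tens1_ext _ _ _ _ 1 _ (mk_linear fl) (mk_linear gl)) => l m d a Gm Ga /=.
by apply: fg Gm => q hq; apply: Ga; lia.
Qed.

Lemma CH_homog (W : lmodType R) (S : int -> submod W) (f : {linear CH -> W}) :
  (forall n d a dm m, homog d a n -> gr dm m ->
    S (n%:Z - dm - \sum_(1 <= q < n.+1) d q) (f (chain (m ⊗ tens a 1 n)))) ->
  forall j x, gr j x -> S j (f x).
Proof.
move=> h j x Gx; have [N xE] := chain_sum x; rewrite xE linear_sum.
apply: submod_sum => i _; have := Gx i.
have fl : linear (fun t => f (@chain i t)) by move=> c y z; rewrite chain_lin linearP.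
have := @tens1_homog _ A M i 1 W (fun k => S (i%:Z - k)) (mk_linear fl) _ (i%:Z - j).
rewrite subKr; apply=> l m d a Gm Ga /=.
rewrite opprD addrA add1n; apply: h => // q hq; apply: Ga; lia.
Qed.
End HochschildChains.

Section HochschildDifferential.
Variables (R : comPzRingType) (A M : gradedModType R).
Variables (mu : ainf_ops A) (muM : bimod_ops A M).

Definition hoch_b_formula (n : nat) (d : nat -> int) (a : nat -> A)
    (dm : int) (m : M) : CH A M :=
  \sum_(1 <= l < n.+2)
   (chain (muM 0 l.-1 (tens a 1 0 ⊗ m ⊗ tens a 1 l.-1) ⊗ tens a l (n.+1 - l))
    + \sum_(1 <= i < n.+2 - l)
       signz R (dm + ✠ d 1 i.-1) *:
         chain (m ⊗ tens (splice a i l (mu l (tens a i l))) 1 (n.+1 - l))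
    + \sum_(n.+2 - l <= i < n.+1 | (1 <= i)%N)
       signz R ((dm + ✠ d 1 i.-1) * ✠ d i n) *:
         chain (muM (n.+1 - i)%N (i + l - n.+2)%N
                  (tens a i (n.+1 - i) ⊗ m ⊗ tens a 1 (i + l - n.+2))
                ⊗ tens a (i + l - n.+1) (n.+1 - l))).

Definition is_hoch_b (b : gHom (-1) (CH A M) (CH A M)) :=
  forall n d a dm m, homog d a n -> gr dm m ->
  b (chain (m ⊗ tens a 1 n)) = hoch_b_formula n d a dm m.

Lemma hoch_b_formula_congr n k m d d' a a' :
  (forall q, (1 <= q < 1 + n)%N -> d q = d' q /\ a q = a' q) ->
  hoch_b_formula n d a k m = hoch_b_formula n d' a' k m.
Proof.
move=> e; have ea q : (1 <= q < 1 + n)%N -> a q = a' q by case/e.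
have ed q : (1 <= q < 1 + n)%N -> d q = d' q by case/e.
apply: eq_big_nat => l hl; congr (_ + _ + _).
- congr (chain (muM _ _ (_ ⊗ _) ⊗ _)); apply: tens_congr => q hq; apply: ea; lia.
- apply: eq_big_nat => i hi; rewrite (@maltese_congr d d'); last first.
    by move=> q hq; apply: ed; lia.
  rewrite (@splice_congr _ _ l i 1 _ (mu l) a a') //; try lia.
  by move=> q hq; apply: ea; lia.
- rewrite big_nat_cond [RHS]big_nat_cond; apply: eq_bigr => i hi.
  rewrite (@maltese_congr d d' 1); last by move=> q hq; apply: ed; lia.
  rewrite (@maltese_congr d d' i); last by move=> q hq; apply: ed; lia.
  congr (_ *: chain (muM _ _ (_ ⊗ _ ⊗ _) ⊗ _));
    apply: tens_congr => q hq; apply: ea; lia.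
Qed.

Lemma hoch_b_formula_lin n k m d q : (1 <= q < 1 + n)%N ->
  lin_at q (fun a => hoch_b_formula n d a k m).
Proof.
move=> hq; apply: lin_at_sum => l hl; apply: lin_at_add; first apply: lin_at_add.
- apply: (lin_at_comp (mk_linear (@chain_lin _ _ _ _))).
  have [ql|lq] := ltnP q l.
    apply: lin_at_pairl; last by apply: tens_const; lia.
    apply: (lin_at_comp (gHom_linear (muM _ _))); apply: lin_at_pairr => //.
    by apply: tens_lin; lia.
  apply: lin_at_pairr; last by apply: tens_lin; lia.
  apply: const_at_comp; apply: const_at_pair => //.
  by apply: tens_const; lia.
- apply: lin_at_sum => i hi; apply: lin_at_scale.
  apply: (lin_at_comp (mk_linear (@chain_lin _ _ _ _))).
  apply: lin_at_pairr => //; apply: (splice_lin (gHom_linear (mu l))); lia.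
- rewrite (_ : (fun a => _) = (fun a => \sum_(n.+2 - l <= i < n.+1)
    signz R ((k + ✠ d 1 i.-1) * ✠ d i n) *:
         chain (muM (n.+1 - i)%N (i + l - n.+2)%N
                  (tens a i (n.+1 - i) ⊗ m ⊗ tens a 1 (i + l - n.+2))
                ⊗ tens a (i + l - n.+1) (n.+1 - l)))); last first.
    apply: funext => a; rewrite big_nat_cond [RHS]big_nat_cond.
    by apply: eq_bigl => i; lia.
  apply: lin_at_sum => i hi; apply: lin_at_scale.
  apply: (lin_at_comp (mk_linear (@chain_lin _ _ _ _))).
  have [iq|qi] := leqP i q.
    apply: lin_at_pairl; last by apply: tens_const; lia.
    apply: (lin_at_comp (gHom_linear (muM _ _))); apply: lin_at_pairl.
      by apply: lin_at_pairl => //; apply: tens_lin; lia.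
    by apply: tens_const; lia.
  have [ql|lq] := ltnP q (i + l - n.+1).
    apply: lin_at_pairl; last by apply: tens_const; lia.
    apply: (lin_at_comp (gHom_linear (muM _ _))); apply: lin_at_pairr.
      by apply: const_at_pair => //; apply: tens_const; lia.
    by apply: tens_lin; lia.
  apply: lin_at_pairr; last by apply: tens_lin; lia.
  apply: const_at_comp; apply: const_at_pair; last by apply: tens_const; lia.
  by apply: const_at_pair => //; apply: tens_const; lia.
Qed.

Lemma hoch_b_formula_lin0 n k c m m' d a :
  hoch_b_formula n d a k (c *: m + m') =
  c *: hoch_b_formula n d a k m + hoch_b_formula n d a k m'.
Proof.
rewrite /hoch_b_formula scaler_sumr -big_split; apply: eq_bigr => l _ /=.
rewrite !scalerDr addrACA; congr (_ + _).
  rewrite addrACA; congr (_ + _).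
    by rewrite tpairPr tpairPl linearP tpairPl chain_lin.
  rewrite scaler_sumr -big_split; apply: eq_bigr => i _.
  by rewrite tpairPl chain_lin scalerDr !scalerA [_ * c]mulrC.
rewrite scaler_sumr -big_split; apply: eq_bigr => i _.
rewrite tpairPr tpairPl linearP tpairPl chain_lin scalerDr !scalerA.
by rewrite [_ * c]mulrC.
Qed.

Lemma maltese_sum (d : nat -> int) i j k : (i <= j <= k)%N ->
  \sum_(i <= q < k) d q = \sum_(i <= q < j) d q + \sum_(j <= q < k) d q.
Proof. by move=> /andP[ij jk]; rewrite (big_cat_nat ij jk). Qed.

Lemma sum_splice_deg (d : nat -> int) p l i n e :
  (1 <= l)%N -> (i <= p < i + n)%N ->
  \sum_(i <= q < i + n) (if (q < p)%N then d q else if q == p then e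
                         else d (q + l - 1)%N)
  = \sum_(i <= q < i + n + l - 1) d q - \sum_(p <= q < p + l) d q + e.
Proof.
move=> l1 hp.
rewrite (@maltese_sum _ i p); last by lia.
rewrite (@maltese_sum _ i p (i + n + l - 1)); last by lia.
rewrite (@big_ltn _ _ _ p (i + n)); last by lia.
rewrite (@maltese_sum _ p (p + l) (i + n + l - 1)); last by lia.
rewrite ltnn eqxx (@eq_big_nat _ _ _ i p _ d); last by move=> q hq; case: ifP => //; lia.
rewrite (_ : (\sum_(p.+1 <= i0 < i + n) _) = \sum_(p + l <= q < i + n + l - 1) d q).
  ring.
rewrite (_ : p + l = p.+1 + (l - 1))%N; last by lia.
rewrite (_ : i + n + l - 1 = i + n + (l - 1))%N; last by lia.
rewrite big_addn (_ : i + n + (l - 1) - (l - 1) = i + n)%N; last by lia.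
apply: eq_big_nat => q hq.
rewrite ltnNge (_ : (p <= q)%N) /=; last by lia.
rewrite (_ : (q == p) = false); last by lia.
by congr d; lia.
Qed.

Lemma splice_gr (d : nat -> int) (a : nat -> A) p l i n e x :
  (1 <= l)%N -> (i <= p < i + n)%N ->
  (forall q, (i <= q < i + n + l - 1)%N -> gr (d q) (a q)) -> gr e x ->
  gr (\sum_(i <= q < i + n + l - 1) d q - \sum_(p <= q < p + l) d q + e)
    (tens (splice a p l x) i n).
Proof.
move=> l1 hp Ga Gx; rewrite -sum_splice_deg //; apply: tens_gr => q hq.
rewrite /splice; case: ltnP => h; first by apply: Ga; lia.
by case: eqP => h'; [|apply: Ga; lia].
Qed.

Lemma tens_mu_gr (d : nat -> int) (a : nat -> A) i l :
  (forall q, (i <= q < i + l)%N -> gr (d q) (a q)) ->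
  gr (\sum_(i <= q < i + l) d q + (2 - l%:Z)) (mu l (tens a i l)).
Proof. by move=> Ga; apply: gHom_deg; apply: tens_gr. Qed.

Lemma tens_muM_gr (d : nat -> int) (a : nat -> A) i r j s k m :
  (forall q, (i <= q < i + r)%N -> gr (d q) (a q)) ->
  (forall q, (j <= q < j + s)%N -> gr (d q) (a q)) -> gr k m ->
  gr (\sum_(i <= q < i + r) d q + k + \sum_(j <= q < j + s) d q
      + (1 - r%:Z - s%:Z)) (muM r s (tens a i r ⊗ m ⊗ tens a j s)).
Proof.
move=> Ga Ga' Gm; apply: gHom_deg.
by do !(apply: tensor_deg_pair => //); apply: tens_gr.
Qed.

Lemma gr_eqdeg (V : gradedModType R) i j (v : V) : gr i v -> i = j -> gr j v.
Proof. by move=> h <-. Qed.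

Lemma hoch_b_formula_deg n d a dm m : homog d a n -> gr dm m ->
  gr (n%:Z - dm - \sum_(1 <= q < n.+1) d q + -1) (hoch_b_formula n d a dm m).
Proof.
move=> Ga Gm; rewrite /hoch_b_formula; apply: submod_sum_seq => l.
rewrite mem_index_iota => hl.
apply: submodD; first apply: submodD.
- apply: chain_deg; apply: gr_eqdeg.
    apply: tensor_deg_pair; last by apply: (@tens_gr _ _ d) => q hq; apply: Ga; lia.
    apply: (@tens_muM_gr d _ _ _ _ _ dm) => // q hq; apply: Ga; lia.
  rewrite (@maltese_sum _ 1 l n.+1); last by lia.
  rewrite addn0 big_geq // (_ : 1 + l.-1 = l)%N; last by lia.
  rewrite (_ : l + (n.+1 - l) = n.+1)%N; last by lia.
  lia.
- apply: submod_sum_seq => i; rewrite mem_index_iota => hi; apply: submodZ.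
  apply: chain_deg; apply: gr_eqdeg.
    apply: tensor_deg_pair; first exact: Gm.
    apply: (@splice_gr d) => //; [lia|lia| |].
      by move=> q hq; apply: Ga; lia.
    by apply: (@tens_mu_gr d) => q hq; apply: Ga; lia.
  rewrite (_ : 1 + (n.+1 - l) + l - 1 = n.+1)%N; last by lia.
  lia.
- rewrite [\sum_(n.+2 - l <= _ < _ | _) _]big_nat_cond; apply: submod_sum => i hi.
  apply: submodZ.
  apply: chain_deg; apply: gr_eqdeg.
    apply: tensor_deg_pair; last by apply: (@tens_gr _ _ d) => q hq; apply: Ga; lia.
    apply: (@tens_muM_gr d _ _ _ _ _ dm) => // q hq; apply: Ga; lia.
  rewrite (@maltese_sum _ 1 i n.+1); last by lia.
  rewrite (@maltese_sum _ 1 (i + l - n.+1) i); last by lia.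
  rewrite (_ : i + (n.+1 - i) = n.+1)%N; last by lia.
  rewrite (_ : 1 + (i + l - n.+2) = i + l - n.+1)%N; last by lia.
  rewrite (_ : i + l - n.+1 + (n.+1 - l) = i)%N; last by lia.
  lia.
Qed.

Lemma hoch_b_exists : exists b, is_hoch_b b.
Proof.
have h n : exists G : {linear tensor M (tpow A n) -> CH A M},
    forall k m d a, gr k m -> (forall q, (1 <= q < 1 + n)%N -> gr (d q) (a q)) ->
    G (m ⊗ tens a 1 n) = hoch_b_formula n d a k m.
  apply: tens_lift1.
  - by move=> k m d d' a a'; apply: hoch_b_formula_congr.
  - by move=> k m d q; apply: hoch_b_formula_lin.
  - by move=> k c m m' d a; apply: hoch_b_formula_lin0.
pose G n := projT1 (cid (h n)); have GP n := projT2 (cid (h n)).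
have [b bP] := CH_lift G.
have {}bP n d a dm m : homog d a n -> gr dm m ->
    b (chain (m ⊗ tens a 1 n)) = hoch_b_formula n d a dm m.
  by move=> Ga Gm; rewrite bP; apply: GP => // q hq; apply: Ga; lia.
have bdeg : degree_map (-1) b.
  apply: (@CH_homog _ _ _ _ (fun j => gr (j - 1))) => n d a dm m Ga Gm.
  by rewrite (bP _ _ _ _ _ Ga Gm); apply: hoch_b_formula_deg.
by exists (mk_gHom bdeg).
Qed.

Definition hoch_b : gHom (-1) (CH A M) (CH A M) := projT1 (cid hoch_b_exists).
Lemma hoch_bP : is_hoch_b hoch_b. Proof. exact: projT2 (cid hoch_b_exists). Qed.

Lemma hoch_bstar_subproof j (f : dual_part (CH A M) j) :
  vanishes_off (j + 1) (dual_part_linear f \o hoch_b).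
Proof.
have fv : vanishes_off j (dual_part_linear f) := submP f.
move=> i x ij Gx; apply: (fv (i + -1)); last exact: (gHom_deg hoch_b Gx).
by apply: contraNneq ij => <-; apply/eqP; lia.
Qed.
Definition hoch_bstar j (f : dual_part (CH A M) j) : dual_part (CH A M) (j + 1) :=
  mk_subm (S := dual_submod (CH A M) (j + 1)) (hoch_bstar_subproof f).
End HochschildDifferential.

Section HochschildCochains.
Variables (R : comPzRingType) (A P : gradedModType R).

Definition coch (j : int) := dprod (fun n : nat => gHom (j - n%:Z) (tpow A n) P).
HB.instance Definition _ j := GRing.Lmodule.on (coch j).
Definition coch_comp j (f : coch j) (n : nat) : gHom (j - n%:Z) (tpow A n) P := f n.

Variables (mu : ainf_ops A) (muP : bimod_ops A P).

Definition hoch_beta_formula j (f : coch j) (N : nat) (d : nat -> int) (a : nat -> A) : P :=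
  \sum_(0 <= n < N.+1) let l := (N - n)%N in
   (\sum_(1 <= i < n.+1)
      signz R (✠ d 1 i.-1) *:
        coch_comp f n (tens (splice a i l.+1 (mu l.+1 (tens a i l.+1))) 1 n)
    + \sum_(1 <= i < l.+2)
      signz R (j * (✠ d 1 i.-1 + 1) + 1) *:
        muP i.-1 (l.+1 - i)%N
          (tens a 1 i.-1 ⊗ coch_comp f n (tens a i n) ⊗ tens a (n + i) (l.+1 - i))).

Definition is_hoch_beta j (f : coch j) (g : coch (j + 1)) :=
  forall N d a, homog d a N ->
  coch_comp g N (tens a 1 N) = hoch_beta_formula f N d a.

Lemma hoch_beta_exists j (f : coch j) : exists g, is_hoch_beta f g.
Proof.
have h N : exists G : gHom (j + 1 - N%:Z) (tpow A N) P,
    forall d a, homog d a N -> G (tens a 1 N) = hoch_beta_formula f N d a.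
  have [| |G GP] := @tens_lift _ A N 1 P (hoch_beta_formula f N).
  - move=> d d' a a' e; have ea q : (1 <= q < 1 + N)%N -> a q = a' q by case/e.
    have ed q : (1 <= q < 1 + N)%N -> d q = d' q by case/e.
    apply: eq_big_nat => n hn; congr (_ + _).
      apply: eq_big_nat => i hi; rewrite (@maltese_congr d d'); last first.
        by move=> q hq; apply: ed; lia.
      rewrite (@splice_congr _ _ _ i 1 _ (mu _) a a') //; try lia.
      by move=> q hq; apply: ea; lia.
    apply: eq_big_nat => i hi; rewrite (@maltese_congr d d'); last first.
      by move=> q hq; apply: ed; lia.
    congr (_ *: _); rewrite (@tens_congr _ _ a a' 1); last first.
      by move=> q hq; apply: ea; lia.
    rewrite (@tens_congr _ _ a a' i); last by move=> q hq; apply: ea; lia.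
    by rewrite (@tens_congr _ _ a a' (n + i)) // => q hq; apply: ea; lia.
  - move=> d q hq; apply: lin_at_sum => n hn; apply: lin_at_add.
      apply: lin_at_sum => i hi; apply: lin_at_scale.
      apply: (lin_at_comp (gHom_linear (coch_comp f n))).
      apply: (splice_lin (gHom_linear (mu _))); lia.
    apply: lin_at_sum => i hi; apply: lin_at_scale.
    apply: (lin_at_comp (gHom_linear (muP _ _))).
    have [qi|iq] := ltnP q i.
      apply: lin_at_pairl; last by apply: tens_const; lia.
      apply: lin_at_pairl; first by apply: tens_lin; lia.
      by apply: const_at_comp; apply: tens_const; lia.
    have [qi|nq] := ltnP q (n + i).
      apply: lin_at_pairl; last by apply: tens_const; lia.
      apply: lin_at_pairr; first by apply: tens_const; lia.
      apply: (lin_at_comp (gHom_linear (coch_comp f n))).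
      by apply: tens_lin; lia.
    apply: lin_at_pairr; last by apply: tens_lin; lia.
    apply: const_at_pair; first by apply: tens_const; lia.
    by apply: const_at_comp; apply: tens_const; lia.
  have Gdeg : degree_map (j + 1 - N%:Z) G.
    apply: (@tens_homog _ _ _ 1 _ (fun k => gr (k + (j + 1 - N%:Z)))) => d a Ga.
    rewrite (GP d a Ga); apply: submod_sum_seq => n; rewrite mem_index_iota => hn.
    apply: submodD.
      apply: submod_sum_seq => i; rewrite mem_index_iota => hi; apply: submodZ.
      apply: gr_eqdeg.
        apply: gHom_deg; apply: (@splice_gr _ _ d) => //.
          by move=> q hq; apply: Ga; lia.
        by apply: (@tens_mu_gr _ _ mu d) => q hq; apply: Ga; lia.
      rewrite (_ : 1 + n + (N - n).+1 - 1 = 1 + N)%N; last by lia.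
      lia.
    apply: submod_sum_seq => i; rewrite mem_index_iota => hi; apply: submodZ.
    apply: gr_eqdeg.
      apply: gHom_deg; apply: tensor_deg_pair; last first.
        by apply: (@tens_gr _ _ d) => q hq; apply: Ga; lia.
      apply: tensor_deg_pair; first by apply: (@tens_gr _ _ d) => q hq; apply: Ga; lia.
      by apply: gHom_deg; apply: (@tens_gr _ _ d) => q hq; apply: Ga; lia.
    rewrite (@maltese_sum _ 1 i (1 + N)); last by lia.
    rewrite (@maltese_sum _ i (n + i) (1 + N)); last by lia.
    rewrite (_ : 1 + i.-1 = i)%N; last by lia.
    rewrite [(i + n)%N]addnC (_ : n + i + ((N - n).+1 - i) = 1 + N)%N; last by lia.
    lia.
  exists (mk_gHom Gdeg) => d a Ga /=; apply: GP => q hq; apply: Ga; lia.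
exists (fun N => projT1 (cid (h N))) => N d a Ga.
exact: (projT2 (cid (h N))).
Qed.

Definition hoch_beta j (f : coch j) : coch (j + 1) := projT1 (cid (hoch_beta_exists f)).
Lemma hoch_betaP j (f : coch j) : is_hoch_beta f (hoch_beta f).
Proof. exact: projT2 (cid (hoch_beta_exists f)). Qed.
End HochschildCochains.

Section Phi.
Variables (R : comPzRingType) (A M : gradedModType R).

Definition is_phi (phi : forall j : int, dual_part (CH A M) j -> coch A (gdual M) j) :=
  forall (j : int) (f : dual_part (CH A M) j) (n : nat) (d : nat -> int) (a : nat -> A)
    (dm : int) (m : M),
  homog d a n -> gr dm m ->
  (coch_comp (phi j f) n (tens a 1 n) : gdual M) m =
  signz R (dm * ✠ d 1 n) * f (chain (m ⊗ tens a 1 n)).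
End Phi.

(* Main.v *)
Require Import Defs.
From mathcomp Require Import all_boot all_order all_algebra.
From mathcomp Require Import boolp zify ring.

Set Implicit Arguments.
Unset Strict Implicit.
Unset Printing Implicit Defensive.
Import Order.TTheory GRing.Theory Num.Theory.
Local Open Scope ring_scope.

(** The map phi is, up to a sign, tensor-hom adjunction: a functional on
    M ⊗ A^{⊗n} that lives in one degree is the same as a homogeneous map from
    A^{⊗n} to the graded dual of M.  A sign depending only on the degrees of the
    two tensor factors is a unit that is constant on each bihomogeneous piece, so
    it can be inserted in the adjunction in either direction
    ([signed_curry_exists], [signed_uncurry_exists]).  Since CH_*(A;M) is the
    direct sum of the M ⊗ A^{⊗n} and the cochains form the product of the
    corresponding Hom modules, applying this in every n gives a bijection
    ([phi_map_bijective]), and testing on homogeneous tensors gives uniqueness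
    ([coch_ext]).

    That phi intertwines b^* and beta is an identity of signed sums, evaluated at
    m and at a_1, ..., a_N ([phi_map_cochain_map]).  The component f_n contributes
    to beta exactly what the summand of b with l = N + 1 - n contributes to b^*
    ([phi_map_summand]):
    - terms where mu_l is applied to a_i, ..., a_(i+l-1) occur on both sides; the
      splicing raises the reduced degree of the word by one, which produces the
      sign (-1)^mu(m) by which the two Koszul signs differ ([phi_map_splice]);
    - for r + s = l - 1, let X, Y, Z be the reduced degrees of the consecutive
      blocks of a_1, ..., a_N of lengths r, n, s.  The term of beta in which the
      dual operation takes the outer blocks and f_n the middle one unfolds,
      by the definition of the dual bimodule, to f applied to the cyclically
      rotated term of b in which mu^M takes the last s inputs, then m, then the
      first r inputs.  With k = mu(m) both signs are k(X + Y + Z) + (k + X + Y) Z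
      modulo 2 ([dual_ops_phi_map]); the case s = 0 is the unsigned first term
      of b. *)

(** * Signs *)

Section Signs.
Variable R : pzRingType.

Lemma signzD (a b : int) : signz R (a + b) = signz R a * signz R b.
Proof.
rewrite /signz -exprD -signr_odd -[RHS]signr_odd.
by congr (_ ^+ nat_of_bool _); lia.
Qed.

Lemma signz_double (a : int) : signz R (a + a) = 1.
Proof. by rewrite /signz -signr_odd (_ : odd _ = false) ?expr0 //; lia. Qed.

Lemma signz_congr (c a b : int) : a = b + (c + c) -> signz R a = signz R b.
Proof. by move=> ->; rewrite signzD signz_double mulr1. Qed.

Lemma signzK (a : int) : signz R a * signz R a = 1.
Proof. by rewrite -signzD signz_double. Qed.
End Signs.

(** * Tensor-hom adjunction with a sign *)

Section SignedCurrying.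
Variables (R : comPzRingType) (V U : gradedModType R) (s : int -> int -> int).

(** As x varies, g x has to be linear although the sign depends on the degree of
    x: the sign is applied on each homogeneous part and the pieces are glued,
    first in v, then in x. *)
Lemma signed_curry_exists k (f : {linear tensor V U -> R^o}) :
  vanishes_off (- k) f ->
  exists g : gHom k U (gdual V), forall i j v x, gr i v -> gr j x ->
    (g x : gdual V) v = signz R (s i j) * f (v ⊗ x).
Proof.
move=> fv.
have /choice[T TP] : forall z : int * U, exists T : {linear V -> R^o},
    forall i v, gr i v -> T v = signz R (s i z.1) *: f (v ⊗ z.2).
  move=> [j x] /=.
  have F_lin i : linear (fun v : V => signz R (s i j) *: f (v ⊗ x)).
    by move=> c v v'; rewrite tpairPl linearP scalerDr !scalerA mulrC.
  have [T TP] := gr_glue (fun i => mk_linear (F_lin i)).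
  by exists T => i v Gv; rewrite (TP _ _ Gv).
have T_lin j : linear (fun x => T (j, x)).
  move=> c x y; apply: linear_ext; apply: gr_ext => i v Gv /=.
  by rewrite !(TP _ _ _ Gv) /= tpairPr linearP scalerDr !scalerA mulrC.
have [G GP] := gr_glue (fun j => mk_linear (T_lin j)).
have {}GP i j v x : gr i v -> gr j x -> G x v = signz R (s i j) * f (v ⊗ x).
  by move=> Gv Gx; rewrite (GP _ _ Gx) /= (TP _ _ _ Gv).
have Goff j x : gr j x -> vanishes_off (- (j + k)) (G x).
  move=> Gx i v ij Gv; rewrite (GP _ _ _ _ Gv Gx).
  rewrite (fv (i + j)) ?mulr0 //; last exact: tensor_deg_pair.
  by apply: contraNneq ij => e; apply/eqP; lia.
(* A homogeneous x gives a functional supported in one degree, and a general x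
   is a finite sum of such. *)
have Gfin x : finite_functional (G x).
  have [t [w [_ Gw ->]]] := gr_decomposes x; rewrite linear_sum.
  apply: (@submod_sum _ _ (Submod (@finite_functional_zero _ V)
    (@finite_functional_lin _ V))) => j _ /=.
  by exists [:: - (j + k)] => i v; rewrite inE; apply: Goff.
have G'lin : linear (fun x => mk_gdual (Gfin x)).
  by move=> c x y; apply: val_inj; rewrite /= linearP.
have G'deg : degree_map k (mk_linear G'lin) by move=> j x /Goff.
by exists (mk_gHom G'deg) => i j v x; exact: GP.
Qed.

Lemma signed_uncurry_exists k (g : gHom k U (gdual V)) :
  exists2 f : {linear tensor V U -> R^o}, vanishes_off (- k) f
    & forall i j v x, gr i v -> gr j x ->
      f (v ⊗ x) = signz R (s i j) * (g x : gdual V) v.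
Proof.
have [||f fP] := @gr_lift2 _ V U R^o
    (fun i j v x => signz R (s i j) *: ((g x : gdual V) v : R^o)).
- by move=> i j c v v' x; rewrite linearP scalerDr !scalerA mulrC.
- move=> i j c v x x'; rewrite linearP.
  rewrite -[gdual_linear _ v]/(c *: (gdual_linear (g x) v : R^o) + gdual_linear (g x') v).
  by rewrite scalerDr !scalerA mulrC.
exists f; last exact: fP.
move=> l t lk [r [hr ->]]; rewrite linear_sum big1_seq // => p /hr[i [j [e Gv Gx]]].
rewrite (fP _ _ _ _ Gv Gx) (gHom_deg g Gx _ _ _ Gv) ?scaler0 //.
by apply: contraNneq lk => e'; apply/eqP; lia.
Qed.
End SignedCurrying.

(** * Reduced degrees and the dual operations *)

Section ReducedDegree.
Variables (R : comPzRingType) (A : gradedModType R).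
Implicit Types (d : nat -> int) (a : nat -> A).

(** The sum of the reduced degrees of the letters of [tens a i n], indexed by the
    start and the length of the block, so that blocks concatenate without
    off-by-one conditions; [redeg d 1 n] is convertible to [✠ d 1 n]. *)
Definition redeg d (i n : nat) : int := \sum_(i <= q < i + n) (d q - 1).

Lemma redegE d i n : redeg d i n = \sum_(i <= q < i + n) d q - n%:Z.
Proof.
rewrite /redeg sumrB; congr (_ - _).
by rewrite big_const_nat iter_addr_0 -mulr_natr mul1r natz addKn.
Qed.

Lemma redeg_cat d i n n' : redeg d i (n + n') = redeg d i n + redeg d (i + n) n'.
Proof. by rewrite /redeg addnA -big_cat_nat //; lia. Qed.

Lemma tens_redeg d a i n :
  (forall q, (i <= q < i + n)%N -> gr (d q) (a q)) ->
  gr (redeg d i n + n%:Z) (tens a i n).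
Proof. by move=> /tens_gr Gt; rewrite redegE subrK. Qed.

Lemma tens_reindex a a' i i' n :
  (forall q, (q < n)%N -> a (i + q)%N = a' (i' + q)%N) -> tens a i n = tens a' i' n.
Proof.
elim: n i i' => [|n IH] i i' e //=; congr (_ ⊗ _).
  by have := e 0%N isT; rewrite !addn0.
by apply: IH => q qn; rewrite !addSnnS; apply: e.
Qed.

Lemma redeg_shift d i n : redeg d i n = \sum_(0 <= q < n) (d (i + q)%N - 1).
Proof.
by rewrite /redeg -{1}[i]add0n big_addn addKn; apply: eq_bigr => q _; rewrite addnC.
Qed.

Lemma redeg_reindex d d' i i' n :
  (forall q, (q < n)%N -> d (i + q)%N = d' (i' + q)%N) -> redeg d i n = redeg d' i' n.
Proof.
by move=> e; rewrite !redeg_shift; apply: eq_big_nat => q qn; rewrite e.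
Qed.

(** In the characterization of the dual operations the two outer blocks of inputs
    are adjacent in one sequence; here the second block starts anywhere, as needed
    when the block between them has been fed to a cochain. *)
Lemma dual_ops_tens (M : gradedModType R) (muM : bimod_ops A M) r s i d a
    dp (p : gdual M) dm (m : M) :
  (forall q, (1 <= q < 1 + r)%N -> gr (d q) (a q)) ->
  (forall q, (i <= q < i + s)%N -> gr (d q) (a q)) -> gr dp p -> gr dm m ->
  (dual_ops muM r s (tens a 1 r ⊗ p ⊗ tens a i s) : gdual M) m =
  signz R (redeg d 1 r * (redeg d i s + dp + dm) + dp + 1) *
    p (muM s r (tens a i s ⊗ m ⊗ tens a 1 r)).
Proof.
move=> Ga Ga' Gp Gm.
(* The reindexing that moves the block starting at i to position r + 1. *)
pose h q := if (q <= r)%N then q else (i + (q - r.+1))%N.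
have h1 q : (q < r)%N -> h (1 + q)%N = (1 + q)%N by rewrite /h; case: ifP => //; lia.
have h2 q : h (r.+1 + q)%N = (i + q)%N by rewrite /h; case: ifP => //; lia.
have -> : tens a 1 r = tens (a \o h) 1 r by apply: tens_reindex => q /h1 /= ->.
have -> : tens a i s = tens (a \o h) r.+1 s.
  by apply: tens_reindex => q _ /=; rewrite h2.
have -> : redeg d 1 r = redeg (d \o h) 1 r by apply: redeg_reindex => q /h1 /= ->.
have -> : redeg d i s = redeg (d \o h) r.+1 s.
  by apply: redeg_reindex => q _ /=; rewrite h2.
apply: dual_opsP => // q hq; rewrite /= /h.
by case: ifP => qr; [apply: Ga | apply: Ga']; lia.
Qed.
End ReducedDegree.

(** * The map phi and its bijectivity *)

Section HochschildPhi.
Variables (R : comPzRingType) (A M : gradedModType R).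

Lemma coch_ext j (g g' : coch A (gdual M) j) :
  (forall n d a dm m, homog d a n -> gr dm m ->
    (coch_comp g n (tens a 1 n) : gdual M) m
    = (coch_comp g' n (tens a 1 n) : gdual M) m) -> g = g'.
Proof.
move=> e; apply: functional_extensionality_dep => n.
apply: val_inj; apply: linear_ext; apply: (@tens_ext _ _ _ _ _ _ 1) => d a Ga.
apply: val_inj; apply: linear_ext; apply: gr_ext => dm m.
by apply: e => q hq; apply: Ga; lia.
Qed.

Lemma dual_chain_linear n (f : {linear CH A M -> R^o}) :
  linear (fun t => f (@chain R A M n t)).
Proof. by move=> c t t'; rewrite chain_lin linearP. Qed.

Lemma dual_chain_vanishes_off j (f : dual_part (CH A M) j) n :
  vanishes_off (- (j - n%:Z)) (mk_linear (@dual_chain_linear n f)).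
Proof.
move=> i t ij Gt /=; apply: (submP f (n%:Z - i)).
  by apply: contraNneq ij => <-; apply/eqP; lia.
by apply: chain_deg; rewrite subKr.
Qed.

(** In terms of the degree e of a word of length n, the reduced degree in the sign
    of phi is e - n. *)
Definition phi_map j (f : dual_part (CH A M) j) : coch A (gdual M) j := fun n =>
  projT1 (cid (signed_curry_exists (fun k e => k * (e - n%:Z)) (@dual_chain_vanishes_off j f n))).

(** The formula for phi on any homogeneous element of A^{⊗n}, not only on pure
    tensors; this is what evaluates it on words that contain a product. *)
Lemma phi_mapE j (f : dual_part (CH A M) j) n k e m (x : tpow A n) :
  gr k m -> gr e x ->
  (coch_comp (phi_map f) n x : gdual M) m
  = signz R (k * (e - n%:Z)) * f (chain (m ⊗ x)).
Proof. rewrite /coch_comp /phi_map; case: cid => g gP /=; exact: gP. Qed.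

Lemma phi_map_tens j (f : dual_part (CH A M) j) n i d a k m :
  (forall q, (i <= q < i + n)%N -> gr (d q) (a q)) -> gr k m ->
  (coch_comp (phi_map f) n (tens a i n) : gdual M) m
  = signz R (k * redeg d i n) * f (chain (m ⊗ tens a i n)).
Proof. by move=> Ga Gm; rewrite (phi_mapE _ Gm (tens_redeg Ga)) addrK. Qed.

Lemma phi_mapP : is_phi phi_map.
Proof.
move=> j f n d a k m Ga Gm.
by rewrite (@phi_map_tens _ _ _ _ d _ k) // => q hq; apply: Ga; lia.
Qed.

Lemma gHom_linearE k (U V : gradedModType R) (c : R) (g g' : gHom k U V) x :
  (c *: g + g' : gHom k U V) x = c *: g x + g' x.
Proof. reflexivity. Qed.

Lemma gdual_linearE c (p p' : gdual M) m : (c *: p + p' : gdual M) m = c * p m + p' m.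
Proof. reflexivity. Qed.

Lemma coch_comp_linearE j c (g g' : coch A (gdual M) j) n :
  coch_comp (c *: g + g') n = c *: coch_comp g n + coch_comp g' n.
Proof. reflexivity. Qed.

Lemma dual_part_linearE j c (f f' : dual_part (CH A M) j) x :
  (c *: f + f' : dual_part (CH A M) j) x = c * f x + f' x.
Proof. reflexivity. Qed.

Lemma phi_map_linear j : linear (@phi_map j).
Proof.
move=> c f f'; apply: coch_ext => n d a k m Ga Gm.
rewrite coch_comp_linearE gHom_linearE gdual_linearE !(phi_mapP _ Ga Gm) dual_part_linearE.
by rewrite mulrDr mulrCA.
Qed.

(** The inverse uncurries every component with the same sign, which squares to
    one, and glues the resulting functionals over the direct sum of chains. *)
Lemma phi_map_bijective j : bijective (@phi_map j).
Proof.
have /choice[h hP] : forall g : coch A (gdual M) j, exists f : dual_part (CH A M) j,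
    forall n d a k m, homog d a n -> gr k m ->
    f (chain (m ⊗ tens a 1 n))
    = signz R (k * ✠ d 1 n) * (coch_comp g n (tens a 1 n) : gdual M) m.
  move=> g.
  have ex_F n : exists F : {linear tensor M (tpow A n) -> R^o},
     vanishes_off (- (j - n%:Z)) F /\
     forall i e m x, gr i m -> gr e x ->
      F (m ⊗ x) = signz R (i * (e - n%:Z)) * (coch_comp g n x : gdual M) m.
    have [F ? ?] := signed_uncurry_exists (fun k e => k * (e - n%:Z)) (coch_comp g n).
    by exists F.
  pose F n := projT1 (cid (ex_F n)); have FP n := projT2 (cid (ex_F n)).
  have [f fP] := CH_lift F.
  have fv : vanishes_off j f.
    move=> i x ij Gx; have [N ->] := chain_sum x; rewrite linear_sum big1 // => n _.
    rewrite fP; apply: ((FP n).1 (n%:Z - i)); last exact: Gx.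
    by apply: contraNneq ij => e; apply/eqP; lia.
  exists (mk_subm (S := dual_submod (CH A M) j) fv) => n d a k m Ga Gm.
  have Gt := @tens_redeg _ _ d a 1 n (fun q (hq : (1 <= q < 1 + n)%N) => Ga q hq).
  by rewrite -[LHS]/(f _) fP ((FP n).2 _ _ _ _ Gm Gt) addrK.
exists h => [f|g].
  apply: val_inj; apply: linear_ext; apply: CH_ext => n d a k m Ga Gm.
  rewrite -[LHS]/(h (phi_map f) (chain (m ⊗ tens a 1 n))).
  by rewrite (hP _ _ _ _ _ _ Ga Gm) (phi_mapP _ Ga Gm) mulrA signzK mul1r.
apply: coch_ext => n d a k m Ga Gm.
by rewrite (phi_mapP _ Ga Gm) (hP _ _ _ _ _ _ Ga Gm) mulrA signzK mul1r.
Qed.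
End HochschildPhi.

(** * Compatibility with the differentials *)

Section PhiCochainMap.
Variables (R : comPzRingType) (A M : gradedModType R).
Variables (mu : ainf_ops A) (muM : bimod_ops A M).
Variables (j : int) (f : dual_part (CH A M) j).

(** The spliced word has reduced degree one more than the original, because mu_l
    has degree 2 - l while l letters become one. *)
Lemma phi_map_splice n l i d a k m : (1 <= i <= n)%N -> homog d a (n + l) -> gr k m ->
  (coch_comp (phi_map f) n (tens (splice a i l.+1 (mu l.+1 (tens a i l.+1))) 1 n)
    : gdual M) m
  = signz R (k * (redeg d 1 (n + l) + 1))
    * f (chain (m ⊗ tens (splice a i l.+1 (mu l.+1 (tens a i l.+1))) 1 n)).
Proof.
move=> hi Ga Gm.
have Gmu : gr (\sum_(i <= q < i + l.+1) d q + (2 - l.+1%:Z)) (mu l.+1 (tens a i l.+1)).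
  by apply: tens_mu_gr => q hq; apply: Ga; lia.
have Gt := @splice_gr _ _ d a i l.+1 1 n _ _ isT hi _ Gmu.
rewrite (@phi_mapE _ _ _ _ _ _ k (redeg d 1 (n + l) + 1 + n%:Z) _ _ Gm) ?addrK //.
apply: gr_eqdeg; first by apply: Gt => q hq; apply: Ga; lia.
rewrite redegE (_ : 1 + n + l.+1 - 1 = 1 + (n + l))%N; last by lia.
lia.
Qed.

(** The sign identity at the heart of the compatibility.  The left-hand sign
    collects the sign of beta, that of the dual operation at the cochain value of
    degree Y + j, and that of phi at the chain whose first factor has degree
    Z + k + X + 1. *)
Lemma dual_ops_phi_map r n s u v d a k m : u = r.+1 -> v = (n + u)%N ->
  homog d a (r + n + s) -> gr k m ->
  signz R (j * (redeg d 1 r + 1) + 1)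
  * (dual_ops muM r s (tens a 1 r ⊗ coch_comp (phi_map f) n (tens a u n) ⊗ tens a v s)
      : gdual M) m
  = signz R (k * redeg d 1 (r + n + s))
    * (signz R ((k + redeg d 1 (r + n)) * redeg d v s)
       * f (chain (muM s r (tens a v s ⊗ m ⊗ tens a 1 r) ⊗ tens a u n))).
Proof.
move=> eu ev Ga Gm.
have Gax q : (1 <= q < 1 + r)%N -> gr (d q) (a q) by move=> hq; apply: Ga; lia.
have Gaz q : (v <= q < v + s)%N -> gr (d q) (a q) by move=> hq; apply: Ga; lia.
have Gx := tens_redeg Gax; have Gz := tens_redeg Gaz.
have Gy : gr (redeg d u n + n%:Z) (tens a u n).
  by apply: tens_redeg => q hq; apply: Ga; lia.
have Gw : gr (redeg d v s + k + redeg d 1 r + 1) (muM s r (tens a v s ⊗ m ⊗ tens a 1 r)).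
  apply: gr_eqdeg.
    by apply: gHom_deg; do !apply: tensor_deg_pair; [exact: Gz|exact: Gm|exact: Gx].
  by lia.
have Gp := gHom_deg (coch_comp (phi_map f) n) Gy.
rewrite (dual_ops_tens muM Gax Gaz Gp Gm).
rewrite (phi_mapE _ Gw Gy) !mulrA -!signzD; congr (_ * _).
rewrite !redeg_cat (_ : 1 + (r + n) = v)%N; last by lia.
rewrite (_ : 1 + r = u)%N; last by lia.
move: (redeg d 1 r) (redeg d u n) (redeg d v s) => X Y Z.
(* Half the difference of the two exponents. *)
apply: (@signz_congr _ (j * X + j + Y + 1 + X * Y - k * Z)); ring.
Qed.

(** The contribution of the operations with l inputs to the Hochschild
    differential. *)
Definition hoch_b_summand N l d a (k : int) (m : M) : CH A M :=
  chain (muM 0 l.-1 (tens a 1 0 ⊗ m ⊗ tens a 1 l.-1) ⊗ tens a l (N.+1 - l))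
  + \sum_(1 <= i < N.+2 - l)
      signz R (k + ✠ d 1 i.-1) *:
        chain (m ⊗ tens (splice a i l (mu l (tens a i l))) 1 (N.+1 - l))
  + \sum_(N.+2 - l <= i < N.+1 | (1 <= i)%N)
      signz R ((k + ✠ d 1 i.-1) * ✠ d i N) *:
        chain (muM (N.+1 - i)%N (i + l - N.+2)%N
                 (tens a i (N.+1 - i) ⊗ m ⊗ tens a 1 (i + l - N.+2))
               ⊗ tens a (i + l - N.+1) (N.+1 - l)).

(** The contribution of the component n of phi f to the component n + l of its
    codifferential. *)
Definition hoch_beta_summand n l d a : gdual M :=
  \sum_(1 <= i < n.+1)
    signz R (✠ d 1 i.-1) *:
      coch_comp (phi_map f) n (tens (splice a i l.+1 (mu l.+1 (tens a i l.+1))) 1 n)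
  + \sum_(1 <= i < l.+2)
    signz R (j * (✠ d 1 i.-1 + 1) + 1) *:
      dual_ops muM i.-1 (l.+1 - i)%N
        (tens a 1 i.-1 ⊗ coch_comp (phi_map f) n (tens a i n) ⊗ tens a (n + i) (l.+1 - i)).

Lemma gdualDE (p p' : gdual M) m : (p + p' : gdual M) m = p m + p' m.
Proof. reflexivity. Qed.

Lemma gdualZE c (p : gdual M) m : (c *: p : gdual M) m = c * p m.
Proof. reflexivity. Qed.

(** Of the l + 1 positions of the cochain inside a dual operation, the last, with
    no letter to its right, matches the first term of the summand of b; the others
    match its rotated terms after a shift of the index by n. *)
Lemma phi_map_summand n l d a k m : homog d a (n + l) -> gr k m ->
  hoch_beta_summand n l d a m
  = signz R (k * ✠ d 1 (n + l)) * f (hoch_b_summand (n + l) l.+1 d a k m).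
Proof.
move=> Ga Gm; rewrite /hoch_beta_summand /hoch_b_summand gdualDE !gdual_sumE.
have -> : ((n + l).+2 - l.+1 = n.+1)%N by lia.
have -> : ((n + l).+1 - l.+1 = n)%N by lia.
rewrite 2!linearD 2!mulrDr [RHS]addrAC [LHS]addrC; congr (_ + _); last first.
  rewrite linear_sum mulr_sumr; apply: eq_big_nat => i hi.
  rewrite gdualZE (phi_map_splice _ Ga Gm) ?linearZ; last by lia.
  rewrite mulrA [RHS]mulrA -!signzD; congr (signz R _ * _).
  by rewrite [LHS]addrC mulrDr mulr1 -addrA.
have dual_term i : (1 <= i <= l.+1)%N ->
    (signz R (j * (✠ d 1 i.-1 + 1) + 1) *: dual_ops muM i.-1 (l.+1 - i)%N
      (tens a 1 i.-1 ⊗ coch_comp (phi_map f) n (tens a i n)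
       ⊗ tens a (n + i) (l.+1 - i)) : gdual M) m
    = signz R (k * ✠ d 1 (n + l)) *
      (signz R ((k + redeg d 1 (i.-1 + n)) * redeg d (n + i) (l.+1 - i)) *
       f (chain (muM (l.+1 - i)%N i.-1 (tens a (n + i) (l.+1 - i) ⊗ m ⊗ tens a 1 i.-1)
           ⊗ tens a i n))).
  move=> hi; have e : (n + l = i.-1 + n + (l.+1 - i))%N by lia.
  rewrite gdualZE e in Ga *; apply: (dual_ops_phi_map _ erefl Ga Gm).
  by lia.
rewrite big_nat_recr //; rewrite [LHS]addrC; congr (_ + _).
  rewrite dual_term ?leqnn // subnn; congr (_ * _).
  by rewrite [redeg d (n + l.+1) 0]big_geq ?addn0 // mulr0 mul1r.
rewrite big_nat_cond linear_sum mulr_sumr [RHS]big_nat_cond -[n.+1]add1n.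
rewrite big_addn (_ : ((n + l).+1 - n = l.+1)%N); last by lia.
apply: eq_big => [i|i /andP[hi _]]; first by lia.
rewrite dual_term; last by lia.
have -> : ((n + l).+1 - (i + n) = l.+1 - i)%N by lia.
have -> : (i + n + l.+1 - (n + l).+2 = i.-1)%N by lia.
have -> : (i + n + l.+1 - (n + l).+1 = i)%N by lia.
rewrite linearZ [(i + n)%N]addnC; congr (_ * (signz R ((_ + _) * _) * _)).
  by congr (\sum_(_ <= q < _) _); lia.
by congr (\sum_(_ <= q < _) _); lia.
Qed.

Lemma phi_map_cochain_map :
  phi_map (hoch_bstar mu muM f) = hoch_beta mu (dual_ops muM) (phi_map f).
Proof.
apply: coch_ext => N d a k m Ga Gm.
rewrite (phi_mapP _ Ga Gm) (hoch_betaP _ _ _ Ga).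
rewrite -[dual_part_linear _ _]/(f (hoch_b mu muM (chain (m ⊗ tens a 1 N)))).
rewrite (hoch_bP _ _ Ga Gm).
rewrite -[hoch_b_formula _ _ _ _ _ _ _]/(\sum_(1 <= l < N.+2) hoch_b_summand N l d a k m).
rewrite -[hoch_beta_formula _ _ _ _ _ _]/(\sum_(0 <= n < N.+1) hoch_beta_summand n (N - n) d a).
rewrite gdual_sumE [RHS]big_nat_rev big_add1 linear_sum mulr_sumr.
apply: eq_big_nat => l hl; rewrite add0n subSS subKn; last by lia.
by have := @phi_map_summand (N - l) l d a k m; rewrite subnK => [->|]; last by lia.
Qed.
End PhiCochainMap.

Theorem theorem3p5 (R : comPzRingType)
    (A : gradedModType R) (mu : ainf_algebra A)
    (M : gradedModType R) (muM : ainf_bimodule mu M) :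
  exists phi : forall j : int, {linear dual_part (CH A M) j -> coch A (gdual M) j},
  [/\ is_phi (fun j => phi j),
      forall psi : forall j : int, dual_part (CH A M) j -> coch A (gdual M) j,
        is_phi psi -> forall j, psi j =1 phi j,
      forall j, bijective (phi j)
    & forall (j : int) (f : dual_part (CH A M) j),
        phi (j + 1) (hoch_bstar mu muM f) =
        hoch_beta mu (dual_ops muM) (phi j f)].
Proof.
exists (fun j => mk_linear (@phi_map_linear _ A M j)); split.
- exact: phi_mapP.
- move=> psi psiP j f; apply: coch_ext => n d a k m Ga Gm.
  by rewrite (psiP _ _ _ _ _ _ _ Ga Gm) (phi_mapP _ Ga Gm).
- exact: phi_map_bijective.
- by move=> j f; apply: phi_map_cochain_map.
Qed.
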